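(* Let $X=\{X_k\}_{k\in\mathbb{Z}}$ be a process with memory parameter $d_0\in\mathbb{R}$ and generalized spectral measure $\nu$, let $(\phi,\psi)$ be an admissible wavelet pair with parameters $(M,\alpha)$, $M>d_0-1/2$, let $W_{j,k}$ be the wavelet coefficients of $X$ and $\sigma_j^2(\nu)=\mathrm{Var}(W_{j,k})$. Assume that there exist $\beta>0$ and $\sigma^2>0$ such that $$\sup_{j\ge1}2^{\beta j}\left|\frac{\sigma_j^2(\nu)}{\sigma^2\,2^{2d_0j}}-1\right|<\infty\quad\text{and}\quad\sup_{n\ge1}\ \sup_{j=1,\dots,J_n}(1+n_j2^{-2j\beta})^{-1}n_j^{-1}\mathrm{Var}\left(\sum_{k=0}^{n_j-1}\frac{W_{j,k}^2}{\sigma_j^2(\nu)}\right)<\infty .$$ Let $\{L_n\}$ and $\{U_n\}$ be two sequences of integers with $0\le L_n<U_n\le J_n$ for all $n$. If $n\asymp2^{(1+2\beta)L_n}$ as $n\to\infty$, then $$\hat d_{\mathcal{I}_n(L_n,U_n)}=d_0+O_{\mathbb{P}}\left(n^{-\beta/(1+2\beta)}\right).$$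
   Context: $a_n\asymp b_n$ means that $a_n/b_n$ is bounded above and bounded away from $0$. Process. $(\Delta X)_k=X_k-X_{k-1}$ and $\Delta^k$ is the $k$th order difference. $X$ has memory parameter $d_0$ with generalized spectral measure $\nu(d\lambda)=|1-e^{-i\lambda}|^{-2d_0}\nu^\ast(d\lambda)$ if for any integer $k\geq 0$ with $k>d_0-1/2$, $\Delta^kX$ is covariance stationary with spectral measure $|1-e^{-i\lambda}|^{2(k-d_0)}\nu^\ast(d\lambda)$ on $[-\pi,\pi]$, where $\nu^\ast$ is a nonnegative symmetric measure on $[-\pi,\pi]$ which, in a neighborhood of the origin, admits a positive and bounded density. Wavelets. Fourier transforms are $\hat\phi(\xi)=\int\phi(t)e^{-i\xi t}dt$, $\hat\psi(\xi)=\int\psi(t)e^{-i\xi t}dt$. A pair $(\phi,\psi)$ of real functions on $\mathbb{R}$ is an admissible wavelet pair with parameters $(M,\alpha)$ ($M\ge1$ integer, $\alpha>1$) if: $\phi,\psi$ are integrable with compact supports, $\hat\phi(0)=1$, $\int\psi^2=1$; $\sup_{\xi}|\hat\psi(\xi)|(1+|\xi|)^\alpha<\infty$; $\int t^l\psi(t)dt=0$ for $l=0,\dots,M-1$; and $t\mapsto\sum_{k\in\mathbb{Z}}k^l\phi(t-k)$ is a polynomial of degree $l$ for $l=0,\dots,M-1$. By convention the supports of $\phi$ and $\psi$ are included in $[-T,0]$ and $[0,T]$ respectively, for an integer $T\ge1$. Wavelet coefficients. $\psi_{j,k}(t)=2^{-j/2}\psi(2^{-j}t-k)$ and $W_{j,k}=\int_{\mathbb{R}}X(t)\psi_{j,k}(t)\,dt$,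 $j\ge0$, $k\in\mathbb{Z}$, with $X(t)=\sum_{k\in\mathbb{Z}}X_k\phi(t-k)$. Since $M>d_0-1/2$, for each $j$ the sequence $\{W_{j,k}\}_{k}$ is covariance stationary, so $\sigma_j^2(\nu)=\mathrm{Var}(W_{j,k})$ does not depend on $k$; wavelet coefficients are understood to be centered, $\mathbb{E}[W_{j,k}]=0$. For sample size $n$, $n_j=\max([2^{-j}(n-T+1)-T+1],0)$ ($[\cdot]$ = integer part), so that $W_{j,k}$, $0\le k<n_j$, depend only on $X_1,\dots,X_n$, and $J_n=\max\{j\ge0:n_j\ge1\}$ (suprema over empty index sets are void). Estimator. $\mathcal{I}_n(j_0,j_1)=\{(j,k):j_0\le j\le j_1,\ 0\le k<n_j\}$. For a finite set $\mathcal{I}$ of pairs $(j,k)$ with cardinality $|\mathcal{I}|$, $\langle\mathcal{I}\rangle=|\mathcal{I}|^{-1}\sum_{(j,k)\in\mathcal{I}}j$, and $$\hat d_{\mathcal{I}}=\mathop{\mathrm{Argmin}}_{d\in\mathbb{R}}\ \log\sum_{(j,k)\in\mathcal{I}}2^{2d(\langle\mathcal{I}\rangle-j)}W_{j,k}^2 .$$ *)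

(* Defs.v *)
From mathcomp Require Import all_boot all_order all_algebra.
From mathcomp Require Import finmap complex.
From mathcomp Require Import all_classical all_reals all_analysis.

Set Implicit Arguments.
Unset Strict Implicit.
Unset Printing Implicit Defensive.

Import Order.TTheory GRing.Theory Num.Theory.
Import numFieldNormedType.Exports.

Local Open Scope classical_set_scope.
Local Open Scope ring_scope.

Section ComplexValued.
Variable R : realType.

Definition modulus (z : R[i]) : R := ComplexField.Normc.normc z.

(* e^{ix} *)
Definition cis (x : R) : R[i] := (cos x +i* sin x)%C.

Definition cintegral d (S : measurableType d) (mu : {measure set S -> \bar R})
    (D : set S) (f : S -> R[i]) : R[i] :=
  ((\int[mu]_(x in D) complex.Re (f x)) +i*
   (\int[mu]_(x in D) complex.Im (f x)))%C.

Definition fourier (f : R -> R) (xi : R) : R[i] :=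
  cintegral (@lebesgue_measure R) setT (fun t => (f t)%:C%C * cis (- (xi * t))).

End ComplexValued.

Section Process.
Context {R : realType} {d : measure_display} {Omega : measurableType d}.
Variable P : probability Omega R.

Definition Delta (Y : int -> Omega -> R) : int -> Omega -> R :=
  fun k w => Y k w - Y (k - 1) w.

Definition covariance_stationary (Y : int -> Omega -> R) : Prop :=
  [/\ forall k, Y k \in Lfun P 2%:E,
      forall k, ('E_P[Y k] = 'E_P[Y 0%R])%E &
      forall k h, covariance P (Y (k + h)) (Y k) = covariance P (Y h) (Y 0)].

(* Normalisation: Cov(Y_{k+h}, Y_k) = \int_{[-pi,pi]} e^{i h lambda} mu(d lambda),
   without the factor 1/(2 pi).  Only the restriction of mu to [-pi, pi] matters. *)
Definition has_spectral_measure (Y : int -> Omega -> R)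
    (mu : {finite_measure set (measurableTypeR R) -> \bar R}) : Prop :=
  covariance_stationary Y /\
  forall h : int,
    (fine (covariance P (Y h) (Y 0)))%:C%C =
    cintegral mu `[- pi, pi] (fun lambda => cis (h%:~R * lambda)).

(* |1 - e^{-i lambda}|^a.  For a < 0 the value at lambda = 0 is 0 instead of
   +oo; this is harmless below since nustar has no atom at 0. *)
Definition diff_gain (a lambda : R) : R := modulus (1 - cis (- lambda)) `^ a.

(* mu(d lambda) = g(lambda) m(d lambda) on [-pi, pi] *)
Definition weighted_measure (mu m : {measure set (measurableTypeR R) -> \bar R})
    (g : R -> R) : Prop :=
  forall A : set (measurableTypeR R), measurable A -> A `<=` `[- pi, pi] ->
    mu A = (\int[m]_(x in A) (g x)%:E)%E.

Definition symmetric_measure (m : {measure set (measurableTypeR R) -> \bar R}) : Prop :=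
  forall A : set (measurableTypeR R), measurable A -> A `<=` `[- pi, pi] ->
    m ((fun x : R => - x) @` A) = m A.

Definition positive_bounded_density_near0
    (m : {measure set (measurableTypeR R) -> \bar R}) : Prop :=
  exists (e B : R) (f : R -> R),
    [/\ 0 < e <= pi, measurable_fun setT f,
        forall x, x \in `]- e, e[ -> 0 < f x <= B &
        forall A : set (measurableTypeR R), measurable A -> A `<=` `]- e, e[ ->
          m A = (\int[@lebesgue_measure R]_(x in A) (f x)%:E)%E].

Definition memory_parameter (X : int -> Omega -> R) (d0 : R)
    (nu : {measure set (measurableTypeR R) -> \bar R}) : Prop :=
  exists nustar : {measure set (measurableTypeR R) -> \bar R},
    [/\ symmetric_measure nustar,
        positive_bounded_density_near0 nustar,
        weighted_measure nu nustar (diff_gain (- (2 * d0))) &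
        forall k : nat, d0 - 2^-1 < k%:R ->
          exists mu : {finite_measure set (measurableTypeR R) -> \bar R},
            weighted_measure mu nustar (diff_gain (2 * (k%:R - d0))) /\
            has_spectral_measure (iter k Delta X) mu].

(* Y_n = O_P(r_n).  The covering event A makes this the boundedness of the outer
   probability of {|Y_n| > C r_n}, so that Y_n need not be measurable; for
   random variables Y_n it is the usual notion. *)
Definition bigO_P (Y : nat -> Omega -> R) (r : nat -> R) : Prop :=
  forall eps : R, 0 < eps ->
    exists2 C : R, 0 < C &
      \forall n \near \oo,
        exists A : set Omega,
          [/\ measurable A, [set w | C * r n < `|Y n w| ] `<=` A &
              (P A <= eps%:E)%E].

End Process.

(* a_n / b_n is eventually bounded above and bounded away from 0 *)
Definition asymp (R : realType) (a b : nat -> R) : Prop :=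
  exists c C : R, 0 < c /\ \forall n \near \oo, c <= a n / b n <= C.

Section Wavelet.
Variable R : realType.
Local Notation leb := (@lebesgue_measure R).

(* For each t, finitely many terms are nonzero when phi has compact support (the
   finitely supported sum over int would be 0 otherwise). *)
Definition translates_sum (phi : R -> R) (c : int -> R) (t : R) : R :=
  \sum_(k \in [set: int]) c k * phi (t - k%:~R).

(* Inclusion of the supports in [-T,0] and [0,T] entails their compactness. *)
Definition admissible_pair (M : nat) (alpha : R) (T : nat) (phi psi : R -> R)
    : Prop :=
  [/\ (1 <= M)%N, 1 < alpha & (1 <= T)%N] /\
  [/\ leb.-integrable setT (EFin \o phi), leb.-integrable setT (EFin \o psi),
      forall t, phi t != 0 -> - T%:R <= t <= 0 &
      forall t, psi t != 0 -> 0 <= t <= T%:R] /\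
  fourier phi 0 = 1 /\
  (\int[leb]_t ((psi t ^+ 2)%:E) = 1)%E /\
  has_ubound (range (fun xi => modulus (fourier psi xi) * (1 + `|xi|) `^ alpha)) /\
  (forall l, (l < M)%N -> \int[leb]_t (t ^+ l * psi t) = 0) /\
  (forall l, (l < M)%N -> exists2 p : {poly R}, size p = l.+1 &
     forall t, translates_sum phi (fun k => k%:~R ^+ l) t = p.[t]).

Definition psi_jk (psi : R -> R) (j : nat) (k : int) (t : R) : R :=
  2 `^ (- (j%:R / 2)) * psi (2 `^ (- j%:R) * t - k%:~R).

Definition wavelet_coef (Omega : Type) (X : int -> Omega -> R) (phi psi : R -> R)
    (j : nat) (k : int) (w : Omega) : R :=
  \int[leb]_t (translates_sum phi (fun l => X l w) t * psi_jk psi j k t).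

(* Num.truncn x is the integer part of x if x >= 0, and 0 if x < 0. *)
Definition ncoef (T n j : nat) : nat :=
  Num.truncn (2 `^ (- j%:R) * (n%:R - T%:R + 1) - T%:R + 1 : R).

(* n_j >= 1 forces 2^j <= n, hence j <= n.  The value is 0 when no n_j is
   positive. *)
Definition Jmax (T n : nat) : nat := (\max_(j < n.+1 | 1 <= ncoef T n j) j)%N.

Definition scale_set (T n j0 j1 : nat) : {fset nat * int} :=
  [fset p in [seq (j, Posz k) | j <- index_iota j0 j1.+1,
                                k <- iota 0 (ncoef T n j)]]%fset.

Definition mean_scale (I : {fset nat * int}) : R :=
  (#|` I|%:R)^-1 * \sum_(p <- I) (p.1)%:R.

(* ln 0 = 0: if all coefficients vanish, the contrast is constant in x, as with
   log 0 = -oo. *)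
Definition contrast (I : {fset nat * int}) (W : nat -> int -> R) (x : R) : R :=
  ln (\sum_(p <- I)
        2 `^ (2 * x * (mean_scale I - (p.1)%:R)) * W p.1 p.2 ^+ 2).

Definition contrast_argmin (I : {fset nat * int}) (W : nat -> int -> R) : set R :=
  [set x | forall y, contrast I W x <= contrast I W y].

(* The contrast may have no minimizer or, when it is constant, many: the estimator
   is any map picking a minimizer whenever there is one. *)
Definition whittle_estimator (Omega : Type) (I : {fset nat * int})
    (W : nat -> int -> Omega -> R) (dhat : Omega -> R) : Prop :=
  forall w, contrast_argmin I (fun j k => W j k w) !=set0 ->
    contrast_argmin I (fun j k => W j k w) (dhat w).

End Wavelet.

(* Main.v *)
(* Normalise the coefficients by [S_j = sum_k W_jk^2 / (sigma^2 2^(2 d0 j))].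
   Up to a positive factor independent of [d], the contrast at [d] is the log of
   [G(d - d0)], where [G(D) = sum_j 2^(2 D (<I> - j)) S_j], and replacing [S_j] by
   [n_j] makes the derivative of [G] vanish at 0, by definition of [<I>].  As
   [n_j] at least halves from one scale to the next, [<I> - L] lies between two
   positive constants, so one of the scales [L], [L+1], [L+2] makes [G] grow
   quadratically on each side of 0, and any minimiser satisfies
   [|D| = O(sum_j (1 + j - L) |S_j - n_j| / n_L)].  The assumptions give
   [E (S_j - n_j)^2 = O(n_j + n_j^2 2^(-2 beta j))], and [n_L] is of order
   [2^(2 beta L)], so Markov's inequality yields the rate [2^(-beta L)].

   That [E W_jk^2] does not depend on [k] is what makes [n_j] the right centring:
   the vanishing moments of [psi] turn [W_jk] into a finite filter of the
   stationary sequence [Delta^M X].  This needs [phi psi] to be integrable with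
   [phi] merely in L^1, hence [psi] essentially bounded: integrating [psi] against
   a Poisson kernel, which is the Fourier transform of an exponential, bounds the
   mean of [psi] over every interval by the L^1 norm of its Fourier transform. *)

From HB Require Import structures.
Require Import Defs.
From mathcomp Require Import all_boot all_order all_algebra.
From mathcomp Require Import finmap complex.
From mathcomp Require Import all_classical all_reals all_analysis measurable_realfun.
From mathcomp Require Import ring lra.

Set Implicit Arguments.
Unset Strict Implicit.
Unset Printing Implicit Defensive.

Import Order.TTheory GRing.Theory Num.Theory.
Import numFieldNormedType.Exports.
Local Open Scope classical_set_scope.
Local Open Scope ring_scope.

(** * Quadratic growth of the contrast *)

(** The square of [1 + y / 2 <= expR (y / 2)], both sides being nonnegative. *)
Lemma expR_ge1Dx_sqr (R : realType) (y : R) :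
  0 <= y -> 1 + y + y ^+ 2 / 4 <= expR y.
Proof.
move=> y0; have -> : 1 + y + y ^+ 2 / 4 = (1 + y / 2) ^+ 2 by field.
rewrite (_ : expR y = expR (y / 2) ^+ 2); last first.
  by rewrite -expRM_natl; congr expR; field.
by rewrite lerXn2r ?nnegrE ?expR_ge0 ?expR_ge1Dx//; lra.
Qed.

(** The hypothesis reads [n i.+1 <= n i - n i.+1], and the right-hand sides telescope. *)
Lemma halving_sum (R : realFieldType) (n : nat -> R) (p : nat) :
  (forall i, 2 * n i.+1 <= n i) -> \sum_(i < p.+1) n i <= 2 * n 0 - n p.
Proof.
move=> h; elim: p => [|p IH]; first by rewrite big_ord1; lra.
by rewrite big_ord_recr /=; have := h p; lra.
Qed.

(** Serves to show that the mean of [i] under the weights [n i] is at most 1, its value for the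
    weights [2^-i] on all of [nat]. There is equality when every halving is exact, which is where
    the right-hand side comes from. *)
Lemma halving_moment (R : realFieldType) (n : nat -> R) (p : nat) :
  (forall i, 2 * n i.+1 <= n i) ->
  \sum_(i < p.+1) (i%:R - 1) * n i <= - (p%:R + 1) * n p.
Proof.
move=> h; elim: p => [|p IH]; first by rewrite big_ord1 /= mulr0n; lra.
rewrite big_ord_recr /= -natr1.
have p0 : 0 <= p%:R :> R by [].
have : 0 <= (p%:R + 1) * (n p - 2 * n p.+1).
  by rewrite mulr_ge0 ?subr_ge0// addr_ge0.
lra.
Qed.

(* [e^y >= 1 + y] is used at all scales but one, where the exponent is positive and
   [e^y >= 1 + y + y^2 / 4]; hence no smallness of [theta] is required. *)
Lemma contrast_growth (R : realType) (n S : nat -> R) (p : nat)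
    (eta theta mu : R) :
  (0 < p)%N -> 0 < n 0%N -> (forall i, 0 <= n i) ->
  (forall i, 2 * n i.+1 <= n i) -> n 0 <= 4 * n 1 -> n 0 <= 8 * n 2 ->
  (forall i, 0 <= S i) ->
  mu * (\sum_(i < p.+1) n i) = \sum_(i < p.+1) i%:R * n i ->
  \sum_(i < p.+1) (1 + i%:R) * `|S i - n i| <= eta * n 0 ->
  eta <= 16^-1 ->
  \sum_(i < p.+1) expR (theta * (mu - i%:R)) * S i <= \sum_(i < p.+1) S i ->
  `|theta| <= 512 * eta.
Proof.
move=> p0 n0 nge0 half n1 n2 Sge0 muE Qle etale Gle.
set N := \sum_(i < p.+1) n i in muE.
have N2 : N <= 2 * n 0 by have := halving_sum p half; have := nge0 p; rewrite -/N; lra.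
have N1 : n 0 <= N.
  by rewrite /N big_ord_recl /= lerDl sumr_ge0.
have mu1 : mu <= 1.
  have := halving_moment p half.
  have -> : \sum_(i < p.+1) (i%:R - 1) * n i = mu * N - N.
    rewrite muE /N -sumrB; apply: eq_bigr => i _; ring.
  have : 0 <= (p%:R + 1) * n p by rewrite mulr_ge0.
  nra.
have n1mu : n 1 <= mu * N.
  rewrite muE; case: p p0 {Qle Gle N N1 N2 muE} => // p _.
  rewrite 2!big_ord_recl /= mul0r add0r mul1r lerDl sumr_ge0// => i _.
  by rewrite mulr_ge0.
(* From [n 0 <= 4 * n 1] and [N <= 2 * n 0]. *)
have mu8 : 8^-1 <= mu by nra.
(* With two scales, a negative [theta] leaves only [c = 1] below, and [mu <= 1] would not separate
   [c] from [mu]. *)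
have mu3 : p = 1%N -> mu <= 3^-1.
  move=> p1; move: muE; rewrite /N p1 !big_ord_recl !big_ord0 /=.
  rewrite mul0r add0r !addr0 mul1r.
  by have := half 0%N; nra.
have Sn i : (i <= p)%N -> `|S i - n i| <= eta * n 0.
  move=> ip; apply: le_trans Qle.
  rewrite (bigD1 (Ordinal (ip : (i < p.+1)%N)))//= -[leLHS]addr0 lerD//.
    by rewrite mulrDl mul1r lerDl mulr_ge0.
  by rewrite sumr_ge0// => j _; rewrite mulr_ge0// addr_ge0.
(* The choice of [mu] cancels the first-order term computed with [n]; what remains involves [S - n]
   only, with coefficients [|mu - i| <= 1 + i]. *)
have lin : - (`|theta| * (eta * n 0)) <=
           \sum_(i < p.+1) theta * (mu - i%:R) * S i.
  have -> : \sum_(i < p.+1) theta * (mu - i%:R) * S i =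
      theta * \sum_(i < p.+1) (mu - i%:R) * (S i - n i).
    rewrite mulr_sumr.
    transitivity (\sum_(i < p.+1) theta * ((mu - i%:R) * (S i - n i)) +
        theta * (mu * N - \sum_(i < p.+1) i%:R * n i)).
      rewrite /N mulrBr !mulr_sumr -sumrB -big_split /=.
      by apply: eq_bigr => i _; ring.
    by rewrite muE subrr mulr0 addr0.
  rewrite lerNl; apply: le_trans (ler_norm _) _.
  rewrite normrN normrM ler_wpM2l//; apply: le_trans Qle.
  apply: le_trans (ler_norm_sum _ _ _) _; apply: ler_sum => i _.
  rewrite normrM ler_wpM2r// ler_norml.
  have : 0 <= i%:R :> R by [].
  by lra.
(* The assumed inequality cancels the sum of the [S i], so the quadratic gain at scale [c] is at
   most the first-order loss bounded in [lin]. *)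
have main c : (c <= p)%N -> 0 <= theta * (mu - c%:R) ->
    theta ^+ 2 * (mu - c%:R) ^+ 2 * S c <= 4 * (`|theta| * (eta * n 0)).
  move=> cp y0.
  have : \sum_(i < p.+1) (1 + theta * (mu - i%:R)) * S i +
      (theta * (mu - c%:R)) ^+ 2 / 4 * S c <=
      \sum_(i < p.+1) expR (theta * (mu - i%:R)) * S i.
    rewrite (bigD1 (Ordinal (cp : (c < p.+1)%N)))//=.
    rewrite [leRHS](bigD1 (Ordinal (cp : (c < p.+1)%N)))//=.
    rewrite addrAC lerD//.
      rewrite -mulrDl ler_wpM2r//; exact: expR_ge1Dx_sqr.
    by apply: ler_sum => i _; rewrite ler_wpM2r// expR_ge1Dx.
  have -> : \sum_(i < p.+1) (1 + theta * (mu - i%:R)) * S i =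
      \sum_(i < p.+1) S i + \sum_(i < p.+1) theta * (mu - i%:R) * S i.
    by rewrite -big_split; apply: eq_bigr => i _ /=; ring.
  by rewrite exprMn; lra.
have eta0 : 0 <= eta.
  by have := Sn 0%N isT; have := normr_ge0 (S 0 - n 0); nra.
have [t0|t0|->] := ltgtP theta 0; last by rewrite normr0; lra.
(* For [theta < 0] the scale must lie to the right of [mu]. Scale 2 is at distance at least 1; if it
   is missing, scale 1 is at distance at least 2/3. This side yields the constant 144 = 4 * (9/4) *
   16. *)
- pose c := if p == 1%N then 1%N else 2%N.
  have cp : (c <= p)%N by rewrite /c; case: eqP p0 => [->//|]; case: (p) => [//|[//|]].
  have mc : 2 / 3 <= c%:R - mu.
    by rewrite /c; case: eqP => [/mu3|_]; lra.
  have nc : n 0 <= 8 * n c by rewrite /c; case: ifP => _; lra.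
  have := main c cp; have := Sn c cp; rewrite ler_norml ltr0_norm//.
  move=> /andP[Sc _] H.
  have {}H : theta ^+ 2 * (mu - c%:R) ^+ 2 * S c <= 4 * (- theta * (eta * n 0)).
    by apply: H; nra.
  have Sc' : n 0 / 16 <= S c by nra.
  have mc2 : 4 / 9 <= (mu - c%:R) ^+ 2 by nra.
  have H2 : theta ^+ 2 * (4 / 9) * (n 0 / 16) <= 4 * (- theta * (eta * n 0)).
    apply: le_trans H; apply: ler_pM => //; try lra.
    - by rewrite mulr_ge0 ?sqr_ge0.
    - by rewrite ler_wpM2l ?sqr_ge0.
  have : (- theta * n 0) * (- theta) <= (- theta * n 0) * (144 * eta) by nra.
  by rewrite ler_pM2l; [lra | nra].
(* For [theta > 0] scale 0 works, at distance [mu >= 1/8], and yields 512 = 4 * 64 * 2. *)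
- have := main 0%N isT; have := Sn 0%N isT; rewrite ler_norml gtr0_norm//.
  move=> /andP[Sc _] H.
  have {}H : theta ^+ 2 * (mu - 0) ^+ 2 * S 0%N <= 4 * (theta * (eta * n 0)).
    by apply: H; rewrite subr0; nra.
  have Sc' : n 0 / 2 <= S 0%N by nra.
  have mc2 : 64^-1 <= (mu - 0) ^+ 2 by nra.
  have H2 : theta ^+ 2 * 64^-1 * (n 0 / 2) <= 4 * (theta * (eta * n 0)).
    apply: le_trans H; apply: ler_pM => //; try lra.
    - by rewrite mulr_ge0 ?sqr_ge0.
    - by rewrite ler_wpM2l ?sqr_ge0.
  have : (theta * n 0) * theta <= (theta * n 0) * (512 * eta) by nra.
  by rewrite ler_pM2l; [lra | nra].
Qed.

(** * Essential boundedness of a function with integrable Fourier transform *)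

Section affine_substitution.
Context {R : realType}.
Implicit Types (c b : R).
Local Notation mu := (@lebesgue_measure R).

Lemma measurable_affine c b :
  measurable_fun [set: R] (fun x : measurableTypeR R => c * x + b : measurableTypeR R).
Proof. by apply: measurable_funD => //; exact: measurable_funM. Qed.

(** By uniqueness of Lebesgue measure: the rescaled image measure agrees with it on the intervals
    []x, y]]. *)
Lemma lebesgue_measure_affine c b (A : set (measurableTypeR R)) :
  0 < c -> measurable A ->
  (mu A = c%:E * mu ((fun x => c * x + b)%R @^-1` A))%E.
Proof.
move=> c0 mA.
pose phi : measurableTypeR R -> measurableTypeR R := fun x => c * x + b.
have mphi : measurable_fun setT phi by exact: measurable_affine.
have @m1 : {measure set (measurableTypeR R) -> \bar R}.
  by refine (pushforward mu phi); exact: mphi.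
pose nu : {measure set (measurableTypeR R) -> \bar R} :=
  mscale (NngNum (ltW c0)) m1.
rewrite (@lebesgue_measure_unique R nu)// => _ [[x y] _ <-] /=.
rewrite /mscale /pushforward /=.
change (lebesgue_measure `]x, y]%classic =
  (c%:E * mu (phi @^-1` `]x, y]%classic))%E).
have -> : phi @^-1` `]x, y]%classic = `]((x - b) / c), ((y - b) / c)]%classic.
  apply/seteqP; split=> z /=; rewrite /phi !in_itv /=;
    by rewrite ltr_pdivrMr// ler_pdivlMr// ltrBlDr lerBrDr (mulrC z).
rewrite !lebesgue_measure_itv /= !lte_fin ltr_pM2r ?invr_gt0// ltrD2r.
case: ifP => _; last by rewrite mule0.
by rewrite -!EFinB -EFinM; congr EFin; field; rewrite gt_eqF.
Qed.

Lemma ge0_integral_affine c b (f : R -> \bar R) :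
  0 < c -> measurable_fun setT f -> (forall x, 0 <= f x)%E ->
  (\int[mu]_x f (c * x + b)%R = (c^-1)%:E * \int[mu]_x f x)%E.
Proof.
move=> c0 mf f0.
pose phi : measurableTypeR R -> measurableTypeR R := fun x => c * x + b.
have mphi : measurable_fun setT phi by exact: measurable_affine.
have @m1 : {measure set (measurableTypeR R) -> \bar R}.
  by refine (pushforward mu phi); exact: mphi.
have -> : (\int[mu]_x f x =
    \int[mscale (NngNum (ltW c0)) m1]_x f x)%E.
  apply: eq_measure_integral => A mA _.
  exact: lebesgue_measure_affine.
rewrite ge0_integral_mscale// ge0_integral_pushforward//= preimage_setT.
by rewrite muleA -EFinM mulVf ?gt_eqF// mul1e.
Qed.

Lemma integrable_affine c b (f : R -> R) :
  0 < c -> mu.-integrable setT (EFin \o f) ->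
  mu.-integrable setT (fun x => (f (c * x + b))%:E).
Proof.
move=> c0 /integrableP[mf foo]; apply/integrableP; split.
  apply: (measurableT_comp mf).
  exact: measurable_affine.
rewrite (@ge0_integral_affine _ _ (fun x => `|(f x)%:E|)%E)//.
  by rewrite lte_mul_pinfty// lee_fin invr_ge0 ltW.
exact: measurableT_comp.
Qed.

Lemma Rintegral_affine c b (f : R -> R) :
  0 < c -> mu.-integrable setT (EFin \o f) ->
  \int[mu]_x f (c * x + b) = c^-1 * \int[mu]_x f x.
Proof.
move=> c0 intf; have /integrableP[mf foo] := intf.
have fp := integrable_pos_fin_num measurableT intf.
have fn := integrable_neg_fin_num measurableT intf.
have Ep : (\int[mu]_x ((EFin \o f) \o (fun x => c * x + b)%R)^\+ x =
    (c^-1)%:E * \int[mu]_x (EFin \o f)^\+%E x)%E.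
  rewrite -(ge0_integral_affine b c0)//; last exact: measurable_funepos.
  by apply: eq_integral => x _; rewrite (funepos_comp (EFin \o f)).
have En : (\int[mu]_x ((EFin \o f) \o (fun x => c * x + b)%R)^\- x =
    (c^-1)%:E * \int[mu]_x (EFin \o f)^\-%E x)%E.
  rewrite -(ge0_integral_affine b c0)//; last exact: measurable_funeneg.
  by apply: eq_integral => x _; rewrite (funeneg_comp (EFin \o f)).
have -> : \int[mu]_x f x = fine (\int[mu]_x (EFin \o f)^\+%E x) -
    fine (\int[mu]_x (EFin \o f)^\-%E x).
  by rewrite -fineB// -integralE.
rewrite mulrBr -!(fineM (x := (c^-1)%:E))// -Ep -En -fineB ?Ep ?En ?fin_numM//.
by rewrite -Ep -En -integralE.
Qed.

End affine_substitution.

(** * Explicit integrals on the half-line *)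

Section half_line.
Context {R : realType}.
Local Notation mu := (@lebesgue_measure R).

Lemma ge0_FTC2_half_line (f F : R -> R) (l : R) :
  (forall x : R, 0 <= x -> 0 <= f x) ->
  (forall x : R, 0 <= x -> {for x, continuous f}) ->
  (forall x : R, 0 <= x -> is_derive x 1 F (f x)) ->
  F x @[x --> +oo%R] --> l ->
  (\int[mu]_(x in `[0%R, +oo[) (f x)%:E = (l - F 0)%:E)%E.
Proof.
move=> f0 cf dF Fl; rewrite EFinB; apply: ge0_continuous_FTC2y => //.
- apply: continuous_in_subspaceT => x; rewrite inE/= in_itv/= andbT; exact: cf.
- by move=> x x0; have := dF x (ltW x0) => -[].
- apply: cvg_at_right_filter.
  have [dF0 _] := dF 0 (lexx _).
  exact/differentiable_continuous/derivable1_diffP.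
- move=> x; rewrite in_itv/= andbT => x0.
  by rewrite derive1E; have [_ ->] := dF x (ltW x0).
Qed.

Lemma integral_expR_half_line (e : R) : 0 < e ->
  (\int[mu]_(x in `[0%R, +oo[) (expR (- (e * x)))%:E = (e^-1)%:E)%E.
Proof.
move=> e0.
transitivity (0 - - (e^-1 * expR (- (e * 0))))%:E; last first.
  by rewrite mulr0 oppr0 expR0 mulr1 sub0r opprK.
apply: (@ge0_FTC2_half_line _ (fun x => - (e^-1 * expR (- (e * x)))) 0).
- by move=> x _; exact: expR_ge0.
- move=> x _; apply: continuous_comp; last exact: continuous_expR.
  by apply: continuousN; apply: continuousM => //; exact: cst_continuous.
- move=> x _; apply: is_derive_eq.
  by rewrite /GRing.scale /=; field; rewrite lt0r_neq0.
- rewrite -[X in _ --> X](mulr0 (- e^-1)) .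
  under eq_fun do rewrite -mulNr.
  apply: cvgMl_tmp.
  apply: (cvg_comp (fun x => e * x) (fun x => expR (- x))); last exact: cvgr_expR.
  by apply: gt0_cvgMry.
Qed.

(** Adding 1 to the cosine keeps the integrand nonnegative, as [ge0_FTC2_half_line] requires;
    [Rintegral_expR_cos_half_line] subtracts it again. *)
Lemma integral_expR_cos_half_line (e u : R) : 0 < e ->
  (\int[mu]_(x in `[0%R, +oo[) (expR (- (e * x)) * (1 + cos (u * x)))%:E =
   (e^-1 + e / (e ^+ 2 + u ^+ 2))%:E)%E.
Proof.
move=> e0.
have eu0 : 0 < e ^+ 2 + u ^+ 2 by rewrite ltr_pwDl ?exprn_gt0 ?sqr_ge0.
pose G x := - (e^-1) + (u * sin (u * x) - e * cos (u * x)) / (e ^+ 2 + u ^+ 2).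
transitivity (0 - expR (- (e * 0)) * G 0)%:E; last first.
  by rewrite /G !mulr0 oppr0 expR0 sin0 cos0 mulr0 mulr1; congr EFin; ring.
apply: (@ge0_FTC2_half_line _ (fun x => expR (- (e * x)) * G x) 0).
- move=> x _; rewrite mulr_ge0 ?expR_ge0//; have := cos_geN1 (u * x); lra.
- move=> x _; apply: continuousM.
    apply: continuous_comp; last exact: continuous_expR.
    by apply: continuousN; apply: continuousM => //; exact: cst_continuous.
  apply: continuousD; first exact: cst_continuous.
  apply: continuous_comp; last exact: continuous_cos.
  by apply: continuousM => //; exact: cst_continuous.
- move=> x _; rewrite /G; apply: is_derive_eq.
  rewrite /GRing.scale /=; field.
  by rewrite (lt0r_neq0 e0) (lt0r_neq0 eu0).
- pose B := e^-1 + (`|u| + e) / (e ^+ 2 + u ^+ 2).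
  apply: norm_cvg0.
  apply: (squeeze_cvgr (f := fun=> 0) (h := fun x => expR (- (e * x)) * B)).
  + near=> x; rewrite normr_ge0 normrM ger0_norm ?expR_ge0//=.
    rewrite ler_wpM2l ?expR_ge0//; apply: le_trans (ler_normD _ _) _.
    apply: lerD; first by rewrite normrN ger0_norm ?invr_ge0 ?(ltW e0).
    rewrite normrM ler_pM//; last by rewrite ger0_norm ?invr_ge0 ?(ltW eu0).
    apply: le_trans (ler_normB _ _) _; rewrite !normrM lerD//.
      by rewrite ler_piMr// ler_norml sin_geN1 sin_le1.
    by rewrite (gtr0_norm e0) ler_piMr ?(ltW e0)// ler_norml cos_geN1 cos_le1.
  + exact: cvg_cst.
  + rewrite -[X in _ --> X](mul0r B); apply: cvgMr_tmp.
    apply: (cvg_comp (fun x => e * x) (fun x => expR (- x))); last exact: cvgr_expR.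
    exact: gt0_cvgMry.
Unshelve. all: by end_near. Qed.

Lemma integral_powR_half_line (a : R) : 1 < a ->
  (\int[mu]_(x in `[0%R, +oo[) ((1 + x) `^ (- a))%:E = ((a - 1)^-1)%:E)%E.
Proof.
move=> a1; have a10 : 0 < a - 1 by rewrite subr_gt0.
transitivity (0 - - ((a - 1)^-1 * (1 + 0) `^ (1 - a)))%:E; last first.
  by rewrite addr0 powR1 mulr1 sub0r opprK.
have dpow (b x : R) : 0 <= x ->
    is_derive x 1 (fun x => (1 + x) `^ b) (b * (1 + x) `^ (b - 1)).
  move=> x0; have x1 : 0 < 1 + x by rewrite ltr_pwDl.
  have d1 := @is_derive1_powR R b _ x1.
  have : is_derive x 1 ((fun y : R => y `^ b) \o (fun x : R => 1 + x))
      ((b * (1 + x) `^ (b - 1)) * 1).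
    apply: is_derive1_comp.
    by apply: is_derive_eq; rewrite add0r mulr1.
  by rewrite mulr1.
apply: (@ge0_FTC2_half_line _ (fun x => - ((a - 1)^-1 * (1 + x) `^ (1 - a))) 0).
- by move=> x _; exact: powR_ge0.
- move=> x x0; have [dx _] := dpow (- a) x x0.
  exact/differentiable_continuous/derivable1_diffP.
- move=> x x0; have := dpow (1 - a) x x0 => d1.
  apply: is_derive_eq; rewrite /GRing.scale /= (_ : 1 - a - 1 = - a); last by ring.
  by field; rewrite lt0r_neq0.
- rewrite -[X in _ --> X](mulr0 (- (a - 1)^-1)).
  under eq_fun do rewrite -mulNr.
  apply: cvgMl_tmp; apply/cvgr0Pnorm_le => eta eta0.
  near=> x.
  have x0 : 0 <= x by near: x; exact: nbhs_pinfty_ge.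
  have x1 : 0 < 1 + x by rewrite ltr_pwDl.
  rewrite ger0_norm ?powR_ge0// -(opprB a) powRN invf_ple ?posrE ?powR_gt0//.
  have -> : eta^-1 = (eta^-1 `^ (a - 1)^-1) `^ (a - 1).
    by rewrite -powRrM mulVf ?lt0r_neq0// powRr1// invr_ge0 ltW.
  apply: ge0_ler_powR; rewrite ?nnegrE ?powR_ge0 ?(ltW a10) ?(ltW x1)//.
  by rewrite -[leLHS]add0r lerD//; near: x; exact: nbhs_pinfty_ge.
Unshelve. all: by end_near. Qed.

End half_line.

(** * Exchanging integrals against a bounded kernel *)

Section fubini_product.
Context {R : realType}.
Local Notation mu := (@lebesgue_measure R).

Lemma integrable_mul_bounded (f h : R -> R) (B : R) :
  mu.-integrable setT (EFin \o f) -> measurable_fun setT h ->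
  (forall t, `|h t| <= B) -> mu.-integrable setT (fun t => (f t * h t)%:E).
Proof.
move=> If mh hB.
have bh : [bounded h t | t in [set: R]].
  exists B; split; first exact: num_real.
  by move=> C BC t _; exact: le_trans (hB _) (ltW BC).
have := @integrableMr _ (measurableTypeR R) R mu setT measurableT _ _ mh bh If.
by apply: eq_integrable => // t _; rewrite /= -EFinM mulrC.
Qed.

(** Tonelli: the absolute value is dominated by [B |f x| |g y|], whose iterated integral factors. *)
Lemma integrable_fubini_kernel (f g : R -> R) (k : R * R -> R) (B : R) :
  mu.-integrable setT (EFin \o f) -> mu.-integrable setT (EFin \o g) ->
  measurable_fun setT k -> (forall z, `|k z| <= B) ->
  (mu \x mu)%E.-integrable setT (fun z : R * R => (f z.1 * (g z.2 * k z))%:E).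
Proof.
move=> If Ig mk kB.
have /integrableP[/measurable_EFinP mf foo] := If.
have /integrableP[/measurable_EFinP mg goo] := Ig.
have mh : measurable_fun setT (fun z : R * R => (f z.1 * (g z.2 * k z))%:E).
  apply/measurable_EFinP; apply: measurable_funM.
    exact: (measurableT_comp mf).
  by apply: measurable_funM => //; exact: (measurableT_comp mg).
apply/integrable12ltyP => //=.
have B0 : 0 <= B by exact: le_trans (normr_ge0 _) (kB (0, 0)).
apply: (@le_lt_trans _ _ (\int[mu]_x \int[mu]_y (`|f x|%:E * (B%:E * `|g y|%:E)))%E).
  apply: ge0_le_integral => //=.
  - by move=> x _; apply: integral_ge0.
  - apply: (@measurable_fun_fubini_tonelli_F _ _ _ _ _ mu
      (fun z => (`|f z.1 * (g z.2 * k z)|%:E)%E)) => //=.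
    apply/measurable_EFinP; apply: measurableT_comp => //.
    exact/measurable_EFinP.
  - apply: (@measurable_fun_fubini_tonelli_F _ _ _ _ _ mu
      (fun z => (`|f z.1|%:E * (B%:E * `|g z.2|%:E))%E)) => //=.
    + apply/measurable_EFinP => /=; apply: measurable_funM.
        by apply: measurableT_comp => //; exact: (measurableT_comp mf).
      by apply: measurable_funM => //; apply: measurableT_comp => //; exact: (measurableT_comp mg).
    + by move=> z; rewrite !mule_ge0// lee_fin.
  - move=> x _; apply: ge0_le_integral => //=.
    + apply/measurable_EFinP; apply: measurableT_comp => //.
      have /measurable_EFinP mh' := mh.
      exact: (measurable_fun_pair2 x mh').
    + apply/measurable_EFinP => /=; apply: measurable_funM => //; apply: measurable_funM => //.
      exact: measurableT_comp.
    + move=> y _; rewrite -!EFinM lee_fin !normrM ler_wpM2l//.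
      by rewrite mulrC ler_wpM2r.
have mag : measurable_fun setT (fun y => (`|g y|)%:E).
  by apply/measurable_EFinP => /=; exact: measurableT_comp.
have E x : (\int[mu]_y (`|f x|%:E * (B%:E * `|g y|%:E)) =
    `|f x|%:E * (B%:E * \int[mu]_y `|g y|%:E))%E.
  rewrite ge0_integralZl//=.
  - by rewrite ge0_integralZl.
  - by apply: emeasurable_funM.
  - by move=> y _; rewrite mule_ge0// lee_fin.
under eq_integral do rewrite E.
have gfin : (\int[mu]_y (`|g y|)%:E)%E \is a fin_num.
  by rewrite ge0_fin_numE// integral_ge0.
rewrite ge0_integralZr//=; last 2 first.
- by apply/measurable_EFinP => /=; exact: measurableT_comp.
- by rewrite mule_ge0// integral_ge0.
rewrite -(fineK gfin) -EFinM muleC lte_mul_pinfty//.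
by rewrite lee_fin mulr_ge0// fine_ge0// integral_ge0.
Qed.

(** Applied once to a cosine kernel and once to the Poisson kernel. The integrability of the outer
    integrand comes along because both applications then bound the integral by that of the absolute
    value. *)
Lemma Rintegral_kernel_swap (f g : R -> R) (k : R * R -> R) (B : R) :
  mu.-integrable setT (EFin \o f) -> mu.-integrable setT (EFin \o g) ->
  measurable_fun setT k -> (forall z, `|k z| <= B) ->
  mu.-integrable setT (fun s => (g s * \int[mu]_t (f t * k (t, s)))%:E) /\
  \int[mu]_t (f t * \int[mu]_s (g s * k (t, s))) =
  \int[mu]_s (g s * \int[mu]_t (f t * k (t, s))).
Proof.
move=> If Ig mk kB.
have Ifk s : mu.-integrable setT (fun t => (f t * k (t, s))%:E).
  exact: integrable_mul_bounded If (measurable_fun_pair1 s mk) (fun t => kB _).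
have Igk t : mu.-integrable setT (fun s => (g s * k (t, s))%:E).
  exact: integrable_mul_bounded Ig (measurable_fun_pair2 t mk) (fun s => kB _).
have I2 := integrable_fubini_kernel If Ig mk kB.
have EF t : (\int[mu]_s (f t * (g s * k (t, s)))%:E =
    (f t * \int[mu]_s (g s * k (t, s)))%:E)%E.
  under eq_integral do rewrite EFinM.
  by rewrite integralZl// EFinM fineK// integrable_fin_num.
have EG s : (\int[mu]_t (f t * (g s * k (t, s)))%:E =
    (g s * \int[mu]_t (f t * k (t, s)))%:E)%E.
  under eq_integral do rewrite mulrCA EFinM.
  by rewrite integralZl// EFinM fineK// integrable_fin_num.
split.
  have mk' : measurable_fun setT (fun z : R * R => k (z.2, z.1)).
    by apply: (measurableT_comp mk); exact: measurable_fun_pair.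
  have := integrable_fubini_F (integrable_fubini_kernel Ig If mk' (fun z => kB _)).
  apply: eq_integrable => // s _; rewrite /fubini_F /= -EG.
  by apply: eq_integral => t _; rewrite mulrCA.
rewrite /Rintegral; congr fine.
have := Fubini I2 => /=.
under eq_integral do rewrite EF.
by under [in X in _ = X -> _]eq_integral do rewrite EG.
Qed.

End fubini_product.

(** * Poisson averages *)

Section poisson.
Context {R : realType}.
Local Notation mu := (@lebesgue_measure R).

Lemma integrable_half_line (f : R -> R) (c : R) :
  measurable_fun (`[0, +oo[ : set R) f -> (forall x, 0 <= x -> 0 <= f x) ->
  (\int[mu]_(x in `[0%R, +oo[) (f x)%:E = c%:E)%E ->
  mu.-integrable `[0%R, +oo[ (EFin \o f).
Proof.
move=> mf f0 fc; apply/integrableP; split; first exact/measurable_EFinP.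
under eq_integral => x.
  rewrite inE/= in_itv/= andbT => x0; rewrite ger0_norm ?f0//.
  over.
by rewrite fc ltry.
Qed.

Lemma integrable_expR_half_line (e : R) : 0 < e ->
  mu.-integrable `[0%R, +oo[ (EFin \o (fun s => expR (- (e * s)))).
Proof.
move=> e0; apply: (integrable_half_line _ _ (integral_expR_half_line e0)).
  apply: measurable_funTS; apply: measurableT_comp => //.
  by apply: measurableT_comp => //; exact: measurable_funM.
by move=> x _; exact: expR_ge0.
Qed.

Lemma integrable_powR_half_line (a : R) : 1 < a ->
  mu.-integrable `[0%R, +oo[ (EFin \o (fun s => (1 + s) `^ (- a))).
Proof.
move=> a1; apply: (integrable_half_line _ _ (integral_powR_half_line a1)).
  apply: measurable_funTS; apply: (measurableT_comp (measurable_powR (- a))).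
  exact: measurable_funD.
by move=> x _; exact: powR_ge0.
Qed.

Lemma Rintegral_expR_cos_half_line (e u : R) : 0 < e ->
  \int[mu]_(s in `[0%R, +oo[) (expR (- (e * s)) * cos (u * s)) =
  e / (e ^+ 2 + u ^+ 2).
Proof.
move=> e0.
have I1 := integrable_expR_half_line e0.
have I2 : mu.-integrable `[0%R, +oo[
    (EFin \o (fun s => expR (- (e * s)) * (1 + cos (u * s)))).
  apply: (integrable_half_line _ _ (integral_expR_cos_half_line u e0)).
    apply: measurable_funTS; apply: measurable_funM.
      apply: measurableT_comp => //.
      by apply: measurableT_comp => //; exact: measurable_funM.
    apply: measurable_funD => //; apply: measurableT_comp.
      by apply: continuous_measurable_fun; exact: continuous_cos.
    exact: measurable_funM.
  move=> x _; apply: mulr_ge0; first exact: expR_ge0.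
  by have := cos_geN1 (u * x); lra.
transitivity (\int[mu]_(s in `[0%R, +oo[) (expR (- (e * s)) * (1 + cos (u * s)))
   - \int[mu]_(s in `[0%R, +oo[) expR (- (e * s))).
  rewrite -RintegralB//; apply: eq_Rintegral => s _; ring.
rewrite /Rintegral integral_expR_half_line// integral_expR_cos_half_line//=.
by ring.
Qed.

(** The Poisson kernel is the cosine transform of [expR (- (e * s))]. Exchanging the integrals
    leaves the cosine and sine transforms of [f], damped by a factor at most 1, so the bound depends
    neither on [e] nor on [x]: the 2 counts the two transforms and [1 / (a - 1)] is the integral of
    [(1 + s)^(-a)]. *)
Lemma poisson_transform_bound (f : R -> R) (a C e x : R) :
  mu.-integrable setT (EFin \o f) -> 1 < a -> 0 < e ->
  (forall s, 0 <= s -> `|\int[mu]_t (f t * cos (s * t))| <= C * (1 + s) `^ (- a)) ->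
  (forall s, 0 <= s -> `|\int[mu]_t (f t * sin (s * t))| <= C * (1 + s) `^ (- a)) ->
  `|\int[mu]_t (f t * (e / (e ^+ 2 + (x - t) ^+ 2)))| <= 2 * C / (a - 1).
Proof.
move=> If a1 e0 Cc Cs.
have C0 : 0 <= C.
  have := Cc 0 (lexx _); rewrite addr0 powR1 mulr1; exact: le_trans.
pose D : set R := `[0%R, +oo[%classic.
have mD : measurable (D : set (measurableTypeR R)) by exact: measurable_itv.
(* Extended by 0, so that both integrals run over the whole line. *)
pose g : R -> R := (fun s => expR (- (e * s))) \_ D.
pose k (z : R * R) := cos ((x - z.1) * z.2).
have Ig : mu.-integrable setT (EFin \o g).
  rewrite /g -restrict_EFin; apply: (integrable_mkcond _ mD).1.
  exact: integrable_expR_half_line.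
have mk : measurable_fun setT k.
  apply: measurableT_comp; first by apply: continuous_measurable_fun; exact: continuous_cos.
  by apply: measurable_funM => //; apply: measurable_funB.
have kB z : `|k z| <= 1 by rewrite ler_norml cos_geN1 cos_le1.
have [IG E] := Rintegral_kernel_swap If Ig mk kB.
have -> : \int[mu]_t (f t * (e / (e ^+ 2 + (x - t) ^+ 2))) =
    \int[mu]_s (g s * \int[mu]_t (f t * k (t, s))).
  rewrite -E; apply: eq_Rintegral => t _; congr (_ * _).
  rewrite -Rintegral_expR_cos_half_line// Rintegral_mkcond.
  by apply: eq_Rintegral => s _; rewrite /g !patchE; case: ifP; rewrite ?mul0r.
have inner s : 0 <= s ->
    `|\int[mu]_t (f t * k (t, s))| <= 2 * C * (1 + s) `^ (- a).
  move=> s0.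
  have Icos : mu.-integrable setT (fun t => (f t * cos (s * t))%:E).
    apply: (integrable_mul_bounded (B := 1) If) => [|t]; last by rewrite ler_norml cos_geN1 cos_le1.
    apply: measurableT_comp; first by apply: continuous_measurable_fun; exact: continuous_cos.
    exact: measurable_funM.
  have Isin : mu.-integrable setT (fun t => (f t * sin (s * t))%:E).
    apply: (integrable_mul_bounded (B := 1) If) => [|t]; last by rewrite ler_norml sin_geN1 sin_le1.
    apply: measurableT_comp; first by apply: continuous_measurable_fun; exact: continuous_sin.
    exact: measurable_funM.
  have -> : \int[mu]_t (f t * k (t, s)) = cos (x * s) * \int[mu]_t (f t * cos (s * t))
      + sin (x * s) * \int[mu]_t (f t * sin (s * t)).
    rewrite -(RintegralZl (cos (x * s)) measurableT Icos).
    rewrite -(RintegralZl (sin (x * s)) measurableT Isin).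
    rewrite -(RintegralD measurableT); first last.
    - exact: (integrableZl _ _ Isin).
    - exact: (integrableZl _ _ Icos).
    apply: eq_Rintegral => t _; rewrite /k /= mulrBl cosB (mulrC t s); ring.
  have := Cc s s0; have := Cs s s0.
  move: (\int[mu]_t (f t * cos (s * t))) (\int[mu]_t (f t * sin (s * t))).
  move=> p q; clear => Hq Hp.
  apply: le_trans (ler_normD _ _) _; rewrite !normrM.
  rewrite -mulrA mulr_natl mulr2n lerD//.
    by rewrite -[leRHS]mul1r ler_pM// ler_norml cos_geN1 cos_le1.
  by rewrite -[leRHS]mul1r ler_pM// ler_norml sin_geN1 sin_le1.
apply: le_trans (le_normr_Rintegral measurableT IG) _.
pose m : R -> R := (fun s => 2 * C * (1 + s) `^ (- a)) \_ D.
have Im : mu.-integrable setT (EFin \o m).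
  rewrite /m -restrict_EFin; apply: (integrable_mkcond _ mD).1.
  exact: (integrableZl _ _ (integrable_powR_half_line a1)).
apply: (@le_trans _ _ (\int[mu]_s m s)).
  apply: (le_Rintegral measurableT _ Im); first exact: integrable_abse IG.
  move=> s _; rewrite normrM; have := inner s.
  move: (\int[mu]_t (f t * k (t, s))) => y.
  rewrite /g /m !patchE; case: ifPn; last by rewrite normr0 mul0r.
  rewrite inE /D /= in_itv /= andbT => s0 /(_ s0) ys.
  clear - s0 e0 ys; rewrite -[leRHS]mul1r ler_pM// ger0_norm ?expR_ge0//.
  by rewrite -expR0 ler_expR oppr_le0 mulr_ge0// ltW.
rewrite /m -Rintegral_mkcond (RintegralZl _ _ (integrable_powR_half_line a1))//.
by rewrite /Rintegral integral_powR_half_line.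
Qed.

End poisson.

(** * Averages over intervals *)

Section interval_average.
Context {R : realType}.
Local Notation mu := (@lebesgue_measure R).

Lemma cvgn_atan_scale (c : R) :
  atan (c * n.+1%:R) @[n --> \oo] --> Num.sg c * (pi / 2).
Proof.
have pos (b : R) : 0 < b -> atan (b * n.+1%:R) @[n --> \oo] --> pi / 2.
  move=> b0; apply: (cvg_comp (fun n => b * n.+1%:R) (@atan R) _ (@cvgy_atan R)).
  apply/cvgryPge => A; near=> n; rewrite mulrC -ler_pdivrMr//.
  rewrite (le_trans (y := n%:R)) ?ler_nat//.
  by near: n; exact: nbhs_infty_ger.
have [c0|c0|->] := ltgtP c 0.
- rewrite ltr0_sg// mulN1r.
  rewrite (_ : (fun n => _) = fun n => - atan (- c * n.+1%:R)); last first.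
    by apply/funext => n; rewrite mulNr atanN opprK.
  by apply: cvgN; apply: pos; rewrite oppr_gt0.
- by rewrite gtr0_sg// mul1r; exact: pos.
- rewrite sgr0 mul0r (_ : (fun n => _) = fun=> 0); first exact: cvg_cst.
  by apply/funext => n; rewrite mul0r atan0.
Unshelve. all: by end_near. Qed.

Lemma continuous_poisson (e : R) : 0 < e ->
  continuous (fun u : R => e / (e ^+ 2 + u ^+ 2)).
Proof.
move=> e0 x; apply: cvgM; first exact: cvg_cst.
apply: cvgV; first by rewrite gt_eqF// ltr_pwDl ?exprn_gt0 ?sqr_ge0.
by apply: cvgD; [exact: cvg_cst|exact: exprn_continuous].
Qed.

Lemma Rintegral_poisson_itv (a b e t : R) : a < b -> 0 < e ->
  \int[mu]_(x in `[a, b]) (e / (e ^+ 2 + (x - t) ^+ 2)) =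
  atan ((b - t) / e) - atan ((a - t) / e).
Proof.
move=> ab e0.
have d (x : R) : is_derive x 1 (fun y : R => atan ((y - t) / e)) (e / (e ^+ 2 + (x - t) ^+ 2)).
  apply: is_derive_eq; rewrite /GRing.scale /=; field.
  by rewrite (gt_eqF e0) gt_eqF// ltr_pwDl ?exprn_gt0 ?sqr_ge0.
rewrite /Rintegral (continuous_FTC2 (F := fun y => atan ((y - t) / e)))//.
- apply: continuous_subspaceT => x.
  apply: (cvg_comp (fun y => y - t) (fun u => e / (e ^+ 2 + u ^+ 2))).
    by apply: cvgB; [exact: cvg_id|exact: cvg_cst].
  exact: continuous_poisson.
- split.
  + by move=> x _; have [] := d x.
  + by apply: cvg_at_right_filter; have [/derivable1_diffP/differentiable_continuous] := d a.
  + by apply: cvg_at_left_filter; have [/derivable1_diffP/differentiable_continuous] := d b.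
- by move=> x _; rewrite derive1E; have [_ ->] := d x.
Qed.

(** The pointwise bound is integrated over [x] in [[a, b]]; after exchanging the integrals, the
    primitive of the Poisson kernel is an arctangent. *)
Lemma poisson_itv_bound (f : R -> R) (K a b e : R) :
  mu.-integrable setT (EFin \o f) -> a < b -> 0 < e ->
  (forall x, `|\int[mu]_t (f t * (e / (e ^+ 2 + (x - t) ^+ 2)))| <= K) ->
  `|\int[mu]_t (f t * (atan ((b - t) / e) - atan ((a - t) / e)))| <= K * (b - a).
Proof.
move=> If ab e0 fK.
pose D : set R := `[a, b]%classic.
have mD : measurable (D : set (measurableTypeR R)) by exact: measurable_itv.
have muD : mu D = (b - a)%:E by rewrite lebesgue_measure_itv /= lte_fin ab EFinB.
pose g : R -> R := \1_D.
pose k (z : R * R) := e / (e ^+ 2 + (z.2 - z.1) ^+ 2).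
have Ig : mu.-integrable setT (EFin \o g).
  exact: integrable_indic_itv.
have pos (z : R * R) : 0 < e ^+ 2 + (z.2 - z.1) ^+ 2.
  by rewrite ltr_pwDl ?exprn_gt0 ?sqr_ge0.
have mk : measurable_fun setT k.
  have mq := continuous_measurable_fun (continuous_poisson e0).
  by apply: (measurableT_comp mq); exact: measurable_funB.
have kB z : `|k z| <= e^-1.
  rewrite /k ger0_norm ?divr_ge0 ?(ltW e0) ?(ltW (pos _))//.
  rewrite ler_pdivrMr// expr2 mulrDr mulrA mulVf ?gt_eqF// mul1r lerDl.
  by rewrite mulr_ge0 ?sqr_ge0// invr_ge0 ltW.
have [IG E] := Rintegral_kernel_swap If Ig mk kB.
have -> : \int[mu]_t (f t * (atan ((b - t) / e) - atan ((a - t) / e))) =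
    \int[mu]_s (g s * \int[mu]_t (f t * k (t, s))).
  rewrite -E; apply: eq_Rintegral => t _; congr (_ * _).
  rewrite -(Rintegral_poisson_itv t ab e0) Rintegral_mkcond.
  apply: eq_Rintegral => s _; rewrite /g patchE indicE.
  by case: ifP => _; rewrite ?mul0r ?mul1r.
clear E; apply: le_trans (le_normr_Rintegral measurableT IG) _.
have IK : mu.-integrable setT (EFin \o (fun s => K * g s)).
  exact: (integrableZl _ _ Ig).
apply: (@le_trans _ _ (\int[mu]_s (K * g s))).
  apply: (le_Rintegral measurableT _ IK); first exact: integrable_abse IG.
  move=> s _; rewrite normrM mulrC; have := fK s.
  rewrite /k /g indicE /=; move: (\int[mu]_t _) => y; clear => yK.
  by rewrite normr_nat ler_wpM2r.
rewrite (RintegralZl _ measurableT Ig) /g /Rintegral integral_indic//.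
by rewrite setIT [X in fine X]muD.
Qed.

(** Take [e = 1 / (n + 1)]: the difference of arctangents tends to [pi] inside the interval and to 0
    outside, and never exceeds [pi] in absolute value, so dominated convergence applies. *)
Lemma Rintegral_itv_bound (f : R -> R) (K a b : R) :
  mu.-integrable setT (EFin \o f) -> a < b ->
  (forall e x, 0 < e -> `|\int[mu]_t (f t * (e / (e ^+ 2 + (x - t) ^+ 2)))| <= K) ->
  pi * `|\int[mu]_(t in `[a, b]) f t| <= K * (b - a).
Proof.
move=> If ab fK.
have /integrableP[/measurable_EFinP mf _] := If.
pose D : set R := `[a, b]%classic.
have mD : measurable (D : set (measurableTypeR R)) by exact: measurable_itv.
pose A n (t : R) : R := atan ((b - t) * n.+1%:R) - atan ((a - t) * n.+1%:R).
have mA n : measurable_fun setT (A n).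
  have matan : measurable_fun setT (@atan R).
    by apply: continuous_measurable_fun => x; exact: continuous_atan.
  apply: measurable_funB; apply: (measurableT_comp matan);
    by apply: measurable_funM => //; exact: measurable_funB.
have Abound n t : `|A n t| <= pi.
  rewrite /A ler_norml.
  have := atan_gtNpi2 ((b - t) * n.+1%:R); have := atan_ltpi2 ((b - t) * n.+1%:R).
  have := atan_gtNpi2 ((a - t) * n.+1%:R); have := atan_ltpi2 ((a - t) * n.+1%:R).
  move: (atan _) (atan _) => u v; lra.
have mfA n : measurable_fun setT (fun t => (f t * A n t)%:E).
  by apply/measurable_EFinP; exact: measurable_funM.
have mfD : measurable_fun setT (fun t => (f t * (pi * \1_D t))%:E).
  apply/measurable_EFinP; apply: measurable_funM => //.
  by apply: measurable_funM.
have IfD : mu.-integrable setT (fun t => (f t * \1_D t)%:E).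
  apply: (integrable_mul_bounded (B := 1) If) => //.
  by move=> t; rewrite indicE; case: (_ \in _); rewrite ?normr1 ?normr0.
have fA : {ae mu, forall t, setT t ->
    (f t * A n t)%:E @[n --> \oo] --> (f t * (pi * \1_D t))%:E}.
  (* At the endpoints one arctangent stays 0 and the limit is [pi / 2], hence convergence almost
     everywhere only. *)
  exists [set a; b]; split.
  - exact: measurableU.
  - apply: countable_lebesgue_measure0; apply: finite_set_countable.
    by rewrite finite_setU.
  move=> t /= H; apply: contrapT => /not_orP[ta tb]; apply: H => _.
  apply: cvg_EFin; first by near=> n.
  apply: cvgMl_tmp.
  have -> : pi * \1_D t = Num.sg (b - t) * (pi / 2) - Num.sg (a - t) * (pi / 2).
    rewrite indicE /D; have [tla|tga|] := ltgtP t a; last by move/ta.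
    - rewrite !gtr0_sg ?subr_gt0//; last exact: lt_trans ab.
      rewrite memNset; first by rewrite mulr0 subrr.
      by rewrite /= in_itv /= leNgt tla.
    - rewrite (@ltr0_sg _ (a - t)) ?subr_lt0//.
      have [tlb|tgb|] := ltgtP t b; last by move/tb.
      + rewrite gtr0_sg ?subr_gt0// mem_set; first by rewrite mulr1; field.
        by rewrite /= in_itv /= !ltW.
      + rewrite ltr0_sg ?subr_lt0// memNset; first by rewrite mulr0 subrr.
        by rewrite /= in_itv /= andbC leNgt tgb.
  by apply: cvgB; exact: cvgn_atan_scale.
have If' : mu.-integrable setT (fun t => (`|f t| * pi)%:E).
  have := integrableZr measurableT pi (integrable_abse If).
  by apply: eq_integrable => // t _; rewrite /= EFinM.
have fAb : {ae mu, forall t n, setT t -> (`|(f t * A n t)%:E| <= (`|f t| * pi)%:E)%E}.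
  by apply: aeW => t n _; rewrite /= lee_fin normrM ler_wpM2l.
have [_ _ cvI] := @dominated_convergence _ (measurableTypeR R) R mu setT
  measurableT _ _ _ mfA mfD fA If' fAb.
have bI n : (`|\int[mu]_t (f t * A n t)%:E| <= (K * (b - a))%:E)%E.
  have IA : mu.-integrable setT (fun t => (f t * A n t)%:E).
    exact: integrable_mul_bounded If (mA n) (Abound n).
  rewrite -(EFin_normr_Rintegral measurableT IA) lee_fin.
  have e0 : 0 < n.+1%:R^-1 :> R by rewrite invr_gt0.
  by have := poisson_itv_bound If ab e0 (fun x => fK _ x e0); rewrite invrK.
have : (`|\int[mu]_t (f t * (pi * \1_D t))%:E| <= (K * (b - a))%:E)%E.
  have cvI' : `|\int[mu]_t (f t * A n t)%:E|%E @[n --> \oo] -->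
      `|\int[mu]_t (f t * (pi * \1_D t))%:E|%E by exact: cvg_abse.
  rewrite -(cvg_lim _ cvI')//; apply: lime_le.
    by apply/cvg_ex; eexists; exact: cvI'.
  by near=> n; exact: bI.
under eq_integral do rewrite mulrCA EFinM.
rewrite (integralZl measurableT IfD) abseM gee0_abs ?lee_fin ?pi_ge0//.
rewrite -(EFin_normr_Rintegral measurableT IfD) -EFinM lee_fin.
rewrite [in X in _ -> X]Rintegral_mkcond.
by under [in X in _ -> X]eq_Rintegral do rewrite patch_indic.
Unshelve. all: by end_near. Qed.

End interval_average.

(** * From averages to almost every point *)

Section ae_bound.
Context {R : realType}.
Local Notation mu := (@lebesgue_measure R).

(** The mean of [f] over a ball has absolute value at most [K], so the mean of [|f - f x|] there is
    at least [|f x| - K]; at a Lebesgue point it tends to 0. *)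
Lemma lebesgue_pt_bound (f : R -> R) (K x : R) :
  mu.-integrable setT (EFin \o f) ->
  (forall a b, a < b -> `|\int[mu]_(t in `[a, b]) f t| <= K * (b - a)) ->
  lebesgue_pt f x -> `|f x| <= K.
Proof.
move=> If fK fx.
have lb r : 0 < r -> ((`|f x| - K)%:E <= davg f x r)%E.
  move=> r0; rewrite /davg /iavg lebesgue_measure_ball ?(ltW r0)//.
  have r20 : 0 < r *+ 2 by rewrite pmulrn_rgt0.
  rewrite inver (gt_eqF r20) lee_pdivlMl//.
  pose D : set R := `](x - r), (x + r)[%classic.
  have DE : ball x r = D by rewrite /D -ball_itv.
  rewrite DE.
  have mD : measurable (D : set (measurableTypeR R)) by exact: measurable_itv.
  have muD : mu D = (r *+ 2)%:E by rewrite -DE lebesgue_measure_ball// ltW.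
  have IfD : mu.-integrable D (EFin \o f) by exact: integrableS If.
  have Ic : mu.-integrable D (EFin \o (fun=> f x)).
    apply: measurable_bounded_integrable => //.
      by rewrite [ltLHS]muD ltry.
    exists `|f x|; split; first exact: num_real.
    by move=> B fB t _; exact: ltW.
  have Id : mu.-integrable D (EFin \o (fun y => f y - f x)).
    by have := integrableB mD IfD Ic; apply: eq_integrable.
  apply: (@le_trans _ _ (`|\int[mu]_(y in D) (f y - f x)|)%:E).
    rewrite -EFinM lee_fin (RintegralB mD IfD Ic).
    rewrite (Rintegral_cst _ mD) [fine _](_ : _ = r *+ 2); last by rewrite [X in fine X]muD.
    have := fK (x - r) (x + r).
    rewrite -Rintegral_itv_bndo_bndc; last exact: integrableS If.
    rewrite -Rintegral_itv_obnd_cbnd; last exact: integrableS If.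
    rewrite -/D; move: (\int[mu]_(t in D) f t) => I; clear -r0.
    rewrite ltrBlDr -addrA ltrDl addr_gt0// => /(_ isT).
    have := lerB_dist (f x * (r *+ 2)) I; rewrite distrC normrM.
    rewrite (gtr0_norm (_ : 0 < r *+ 2)) ?pmulrn_rgt0// mulr2n; lra.
  rewrite (EFin_normr_Rintegral mD Id); apply: le_abse_integral => //.
  by have /integrableP[] := Id.
have fx' : davg f x r @[r --> 0^'+] --> 0%:E by exact: fx.
rewrite -subr_le0 -lee_fin -(cvg_lim _ fx')//.
apply: lime_ge; first by apply/cvg_ex; eexists; exact: fx'.
by near=> r; apply: lb.
Unshelve. all: by end_near. Qed.

Lemma ae_bounded_fourier (f : R -> R) (a C : R) :
  mu.-integrable setT (EFin \o f) -> 1 < a ->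
  (forall s, 0 <= s -> `|\int[mu]_t (f t * cos (s * t))| <= C * (1 + s) `^ (- a)) ->
  (forall s, 0 <= s -> `|\int[mu]_t (f t * sin (s * t))| <= C * (1 + s) `^ (- a)) ->
  exists K, {ae mu, forall t, `|f t| <= K}.
Proof.
move=> If a1 Cc Cs; exists (2 * C / (a - 1) / pi).
have : {ae mu, forall t, lebesgue_pt f t}.
  apply: lebesgue_differentiation; apply: open_integrable_locally => //.
  exact: openT.
apply: (@filterS _ _ (ae_filter_ringOfSetsType mu)) => t; apply: lebesgue_pt_bound => // u v uv.
rewrite mulrAC ler_pdivlMr ?pi_gt0// mulrC.
apply: Rintegral_itv_bound => // e x e0.
exact: poisson_transform_bound.
Qed.

End ae_bound.

Section integrability.
Context {R : realType}.
Local Notation mu := (@lebesgue_measure R).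

(** Truncating [h] at level [|K|] gives an everywhere bounded function that agrees with [h] almost
    everywhere. *)
Lemma integrable_mul_ae_bounded (f h : R -> R) (K : R) :
  mu.-integrable setT (EFin \o f) -> measurable_fun setT h ->
  {ae mu, forall t, `|h t| <= K} -> mu.-integrable setT (fun t => (f t * h t)%:E).
Proof.
move=> If mh hK.
have /integrableP[/measurable_EFinP mf _] := If.
pose h' t := Num.max (- `|K|) (Num.min (h t) `|K|).
have mh' : measurable_fun setT h'.
  by apply: measurable_maxr => //; apply: measurable_minr.
have h'K t : `|h' t| <= `|K|.
  have K0 := normr_ge0 K.
  by rewrite ler_norml /h' le_max lexx /= ge_max ge_min lexx orbT andbT; lra.
have Ih' := integrable_mul_bounded If mh' h'K.
have mfh : measurable_fun setT (fun t => (f t * h t)%:E).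
  by apply/measurable_EFinP; exact: measurable_funM.
have /integrableP[mfh' foo] := Ih'.
apply/integrableP; split => //.
rewrite (_ : integral _ _ _ = \int[mu]_t `|(f t * h' t)%:E|)%E//.
apply: ae_eq_integral => //; try exact: measurableT_comp.
apply: (@filterS _ _ (ae_filter_ringOfSetsType mu)) hK => t hK _.
rewrite /h'; have := ler_norm K; move: hK; rewrite ler_norml => /andP[h1 h2] K1.
by rewrite min_l ?max_r//; lra.
Qed.

Lemma Rintegral_sum d (S : measurableType d) (m : {measure set S -> \bar R})
    (n : nat) (F : nat -> S -> R) :
  (forall i, (i < n)%N -> m.-integrable setT (EFin \o F i)) ->
  m.-integrable setT (fun x => (\sum_(i < n) F i x)%:E) /\
  \int[m]_x (\sum_(i < n) F i x) = \sum_(i < n) \int[m]_x F i x.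
Proof.
elim: n => [|n IH] IF.
  rewrite big_ord0; under eq_fun do rewrite big_ord0.
  split; first exact: integrable0.
  under eq_Rintegral do rewrite big_ord0.
  by rewrite /Rintegral integral0.
have [I1 E1] : m.-integrable setT (fun x => (\sum_(i < n) F i x)%:E) /\
    \int[m]_x (\sum_(i < n) F i x) = \sum_(i < n) \int[m]_x F i x.
  by apply: IH => i ni; apply: IF; exact: ltnW.
have In : m.-integrable setT (EFin \o F n) by exact: IF.
split.
  have := integrableD measurableT I1 In; apply: eq_integrable => // x _.
  by rewrite big_ord_recr.
under eq_Rintegral do rewrite big_ord_recr /=.
by rewrite (RintegralD measurableT I1 In) E1 big_ord_recr.
Qed.

End integrability.

Section fourier_decay.
Context {R : realType}.
Local Notation mu := (@lebesgue_measure R).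

Lemma fourierE (f : R -> R) (xi : R) :
  fourier f xi = ((\int[mu]_t (f t * cos (xi * t))) +i*
                  (\int[mu]_t (f t * - sin (xi * t))))%C.
Proof.
by rewrite /fourier /cintegral; congr (_ +i* _)%C; apply: eq_Rintegral => t _;
  rewrite /cis /= ?cosN ?sinN ?mul0r ?subr0 ?addr0.
Qed.

Lemma modulus_ge (a b : R) : `|a| <= modulus (a +i* b)%C /\ `|b| <= modulus (a +i* b)%C.
Proof.
by split; rewrite /modulus /= -sqrtr_sqr ler_wsqrtr// ?lerDl ?lerDr sqr_ge0.
Qed.

(** The cosine and sine transforms are, up to sign, the real and imaginary parts of the Fourier
    transform, hence bounded by its modulus. *)
Lemma fourier_decay_bounded (f : R -> R) (alpha : R) :
  mu.-integrable setT (EFin \o f) -> 1 < alpha ->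
  has_ubound (range (fun xi => modulus (fourier f xi) * (1 + `|xi|) `^ alpha)) ->
  exists K, {ae mu, forall t, `|f t| <= K}.
Proof.
move=> If a1 [C HC].
have CE s : 0 <= s -> modulus (fourier f s) <= C * (1 + s) `^ (- alpha).
  move=> s0; rewrite powRN ler_pdivlMr ?powR_gt0 ?ltr_pwDl//.
  by apply: HC; exists s => //=; rewrite ger0_norm.
apply: (ae_bounded_fourier (C := C) If a1) => s /CE; apply: le_trans.
  by rewrite fourierE; have [] := modulus_ge (\int[mu]_t (f t * cos (s * t)))
    (\int[mu]_t (f t * - sin (s * t))).
have [_] := modulus_ge (\int[mu]_t (f t * cos (s * t)))
    (\int[mu]_t (f t * - sin (s * t))).
rewrite -fourierE; apply: le_trans.
have Is : mu.-integrable setT (fun t => (f t * sin (s * t))%:E).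
  apply: (integrable_mul_bounded (B := 1) If) => [|t]; last by rewrite ler_norml sin_geN1 sin_le1.
  apply: measurableT_comp; first by apply: continuous_measurable_fun; exact: continuous_sin.
  exact: measurable_funM.
under [X in _ <= `|X|]eq_Rintegral do rewrite mulrN -mulN1r.
by rewrite (RintegralZl _ measurableT Is) mulN1r normrN.
Qed.

End fourier_decay.

(** * Wavelet coefficients as filters of a stationary sequence *)

Section filter.
Context {R : realType}.
Local Notation mu := (@lebesgue_measure R).

(** Replaces a finitely supported sum, whose support moves with [t], by a sum over a prescribed
    window, which can be exchanged with the integral. *)
Lemma translates_sum_window (phi : R -> R) (c : int -> R) (t : R) (m : int) (N : nat) :
  (forall l : int, phi (t - l%:~R) != 0 -> m <= l < m + N%:Z) ->
  translates_sum phi c t =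
  \sum_(i < N) c (m + i%:Z) * phi (t - (m + i%:Z)%:~R).
Proof.
move=> win; rewrite /translates_sum.
pose r := [seq m + i%:Z | i <- iota 0 N].
rewrite (@fsbigE _ _ _ _ _ r) //.
- rewrite big_map -[in LHS](subn0 N) -/(index_iota 0 N) big_mkord.
  by apply: eq_bigl => i; rewrite in_setT.
- rewrite map_inj_uniq ?iota_uniq// => i j /addrI; by case.
- move=> l _; apply: contraNeq => H.
  have /win : phi (t - l%:~R) != 0 by apply: contraNneq H => ->; rewrite mulr0.
  move=> /andP[ml lm]; apply/mapP; exists `|l - m|%N.
    rewrite mem_iota /= add0n -ltz_nat gez0_abs ?subr_ge0//.
    by rewrite ltrBlDl.
  by rewrite gez0_abs ?subr_ge0// addrCA subrr addr0.
Qed.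

Lemma psi_jkE (psi : R -> R) (j : nat) (k : int) (t : R) :
  psi_jk psi j k t =
  2 `^ (- (j%:R / 2)) * psi ((2 ^ j)%:R^-1 * t - k%:~R).
Proof. by rewrite /psi_jk (powRN _ j%:R) powR_mulrn// natrX. Qed.

Lemma psi_jk_shift (psi : R -> R) (j : nat) (k : int) (t : R) :
  psi_jk psi j k t = psi_jk psi j 0 (t - ((2 ^ j)%:Z * k)%:~R).
Proof.
rewrite !psi_jkE subr0 mulrBr; congr (_ * psi (_ - _)).
by rewrite intrM mulrA mulVf ?mul1r// pnatr_eq0 -lt0n expn_gt0.
Qed.

(** The first condition puts [t] between [2^j k] and [2^j k + 2^j T], the second puts [l] between
    [t] and [t + T]. Both ends are attainable, hence the successor. *)
Lemma psi_jk_window (phi psi : R -> R) (T j : nat) (k l : int) (t : R) :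
  (forall t, phi t != 0 -> - T%:R <= t <= 0) ->
  (forall t, psi t != 0 -> 0 <= t <= T%:R) ->
  psi_jk psi j k t != 0 -> phi (t - l%:~R) != 0 ->
  (2 ^ j)%:Z * k <= l < (2 ^ j)%:Z * k + (2 ^ j * T + T).+1%:Z.
Proof.
move=> sphi spsi; rewrite psi_jkE mulf_eq0 negb_or => /andP[_ /spsi/andP[h1 h2]].
move=> /sphi/andP[h3 h4].
have s0 : 0 < (2 ^ j)%:R :> R by rewrite ltr0n expn_gt0.
have h1' : ((2 ^ j)%:Z * k)%:~R <= t :> R.
  by rewrite intrM mulrC -ler_pdivlMr// mulrC -subr_ge0.
have h2' : t <= ((2 ^ j)%:Z * k)%:~R + (2 ^ j)%:R * T%:R.
  by rewrite intrM -mulrDr -ler_pdivrMl// addrC -lerBlDr.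
apply/andP; split.
  by rewrite -(ler_int R); apply: le_trans h1' _; rewrite -subr_le0.
rewrite intS (addrC 1) addrA ltzD1 -(ler_int R) intrD.
rewrite -pmulrn natrD natrM; lra.
Qed.

Lemma integrable_translate_psi (phi psi : R -> R) (K : R) (j : nat) (k : int) (m : int) :
  mu.-integrable setT (EFin \o phi) -> mu.-integrable setT (EFin \o psi) ->
  {ae mu, forall t, `|psi t| <= K} ->
  mu.-integrable setT (fun t => (phi (t - m%:~R) * psi_jk psi j k t)%:E).
Proof.
move=> Iphi Ipsi psiK.
have s0 : 0 < (2 ^ j)%:R :> R by rewrite ltr0n expn_gt0.
(* In the variable [u = 2^-j t - k] the factor is [psi] itself, so its almost sure bound applies as
   it stands. *)
pose F u := 2 `^ (- (j%:R / 2)) * (phi ((2 ^ j)%:R * u + ((2 ^ j)%:R * k%:~R - m%:~R)) * psi u).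
have IF : mu.-integrable setT (EFin \o F).
  have /integrableP[/measurable_EFinP mpsi _] := Ipsi.
  exact: (integrableZl measurableT _
    (integrable_mul_ae_bounded (integrable_affine _ s0 Iphi) mpsi psiK)).
have s1 : 0 < (2 ^ j)%:R^-1 :> R by rewrite invr_gt0.
have := integrable_affine (- k%:~R) s1 IF.
apply: eq_integrable => // t _; rewrite /= /F psi_jkE; congr EFin.
rewrite [RHS]mulrCA; congr (_ * (phi _ * _)).
by field; rewrite gt_eqF.
Qed.

End filter.

Section wavelet_filter.
Context {R : realType}.
Local Notation mu := (@lebesgue_measure R).

Lemma integrable_monomial_psi (psi : R -> R) (T l : nat) :
  mu.-integrable setT (EFin \o psi) ->
  (forall t, psi t != 0 -> 0 <= t <= T%:R) ->
  mu.-integrable setT (fun t => (t ^+ l * psi t)%:E).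
Proof.
move=> Ipsi spsi.
pose D : set R := `[0, T%:R]%classic.
have mD : measurable (D : set (measurableTypeR R)) by exact: measurable_itv.
have mh : measurable_fun setT (fun t : R => t ^+ l * \1_D t).
  by apply: measurable_funM; [exact: measurable_funX|exact: measurable_indic].
have hB t : `|t ^+ l * \1_D t| <= T%:R ^+ l.
  rewrite indicE; have [|_] := boolP (t \in D); last by rewrite mulr0 normr0 exprn_ge0.
  rewrite inE /D /= in_itv /= => /andP[t0 tT].
  by rewrite mulr1 normrX ger0_norm// lerXn2r ?nnegrE.
have := integrable_mul_bounded Ipsi mh hB; apply: eq_integrable => // t _.
congr EFin; rewrite indicE.
have [->|/spsi psi0] := eqVneq (psi t) 0; first by rewrite mul0r mulr0.
by rewrite mem_set ?mulr1 1?mulrC// /D /= in_itv.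
Qed.

Lemma Rintegral_poly_psi (psi : R -> R) (T M j : nat) (p : {poly R}) :
  mu.-integrable setT (EFin \o psi) ->
  (forall t, psi t != 0 -> 0 <= t <= T%:R) ->
  (forall l, (l < M)%N -> \int[mu]_t (t ^+ l * psi t) = 0) ->
  (size p <= M)%N ->
  \int[mu]_t (p.[t] * psi_jk psi j 0 t) = 0.
Proof.
move=> Ipsi spsi mom pM.
set s : R := (2 ^ j)%:R.
have s0 : 0 < s by rewrite ltr0n expn_gt0.
pose c : R := 2 `^ (- (j%:R / 2)).
pose F i (u : R) := p`_i * s ^+ i * c * (u ^+ i * psi u).
have IF i : mu.-integrable setT (EFin \o F i).
  exact: (integrableZl measurableT _ (integrable_monomial_psi i Ipsi spsi)).
have [IG EG] := Rintegral_sum (n := size p) (fun i _ => IF i).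
have s1 : 0 < s^-1 by rewrite invr_gt0.
have -> : \int[mu]_t (p.[t] * psi_jk psi j 0 t) =
    \int[mu]_t ((fun u => \sum_(i < size p) F i u) (s^-1 * t + 0)).
  apply: eq_Rintegral => t _; rewrite /= psi_jkE subr0 addr0 -/s -/c.
  rewrite horner_coef mulr_suml; apply: eq_bigr => i _; rewrite /F exprMn exprVn.
  by field; rewrite gt_eqF// exprn_gt0.
rewrite (Rintegral_affine 0 s1 IG) EG big1 ?mulr0// => i _.
rewrite /F (RintegralZl _ measurableT (integrable_monomial_psi i Ipsi spsi)).
by rewrite mom ?mulr0//; exact: leq_trans (ltn_ord i) pM.
Qed.

(** The weight [h i] is the integral of [phi (t - i)] against [psi_jk psi j 0]; a translation by
    [2^j k] shows that it serves every [k]. The moment of order [l] of [h] is the integral of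
    [psi_jk psi j 0] against the sum of the [i^l phi (t - i)], a polynomial of degree [l < M], so it
    vanishes. *)
Lemma wavelet_coef_filter (phi psi : R -> R) (M T j : nat) (alpha : R) :
  admissible_pair M alpha T phi psi ->
  exists h : nat -> R,
    (forall l, (l < M)%N -> \sum_(i < (2 ^ j * T + T).+1) h i * i%:R ^+ l = 0) /\
    forall (Omega : Type) (X : int -> Omega -> R) (k : int) (w : Omega),
      wavelet_coef X phi psi j k w =
      \sum_(i < (2 ^ j * T + T).+1) h i * X ((2 ^ j)%:Z * k + i%:Z) w.
Proof.
move=> [[M1 a1 T1] [[Iphi Ipsi sphi spsi] [_ [_ [decay [mom poly]]]]]].
have [K psiK] := fourier_decay_bounded Ipsi a1 decay.
have Itp k m := integrable_translate_psi j k m Iphi Ipsi psiK.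
set N := (2 ^ j * T + T).+1.
pose h (i : nat) := \int[mu]_t (phi (t - i%:Z%:~R) * psi_jk psi j 0 t).
have window (c : int -> R) (k : int) t : translates_sum phi c t * psi_jk psi j k t =
   \sum_(i < N) c ((2 ^ j)%:Z * k + i%:Z) *
     (phi (t - ((2 ^ j)%:Z * k + i%:Z)%:~R) * psi_jk psi j k t).
  have [->|psi0] := eqVneq (psi_jk psi j k t) 0.
    by rewrite mulr0 big1// => i _; rewrite !mulr0.
  rewrite (@translates_sum_window _ _ _ _ ((2 ^ j)%:Z * k) N); last first.
    by move=> l; exact: (psi_jk_window sphi spsi psi0).
  by rewrite mulr_suml; apply: eq_bigr => i _; rewrite -[LHS]mulrA.
have expand (c : int -> R) (k : int) :
    \int[mu]_t (translates_sum phi c t * psi_jk psi j k t) =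
    \sum_(i < N) c ((2 ^ j)%:Z * k + i%:Z) *
      \int[mu]_t (phi (t - ((2 ^ j)%:Z * k + i%:Z)%:~R) * psi_jk psi j k t).
  under eq_Rintegral do rewrite window.
  pose F (i : nat) t := c ((2 ^ j)%:Z * k + i%:Z) *
     (phi (t - ((2 ^ j)%:Z * k + i%:Z)%:~R) * psi_jk psi j k t).
  have IF i : mu.-integrable setT (EFin \o F i).
    exact: (integrableZl measurableT _ (Itp k _)).
  have [_ E] := Rintegral_sum (n := N) (fun i _ => IF i).
  rewrite [LHS]E; apply: eq_bigr => i _.
  exact: (RintegralZl _ measurableT (Itp k _)).
exists h; split=> [l lM|Omega X k w].
  have [p sp pE] := poly l lM.
  transitivity (\int[mu]_t (p.[t] * psi_jk psi j 0 t)).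
    under eq_Rintegral do rewrite -pE.
    rewrite expand; apply: eq_bigr => i _.
    by rewrite mulr0 !add0r mulrC /h.
  by apply: (Rintegral_poly_psi (M := M) _ Ipsi spsi mom); rewrite sp.
rewrite /wavelet_coef expand; apply: eq_bigr => i _; rewrite mulrC; congr (_ * _).
pose G t := phi (t - i%:Z%:~R) * psi_jk psi j 0 t.
have IG : mu.-integrable setT (EFin \o G) by exact: Itp.
transitivity (\int[mu]_t G (1 * t + - ((2 ^ j)%:Z * k)%:~R)); last first.
  by rewrite (Rintegral_affine _ _ IG)// invr1 mul1r.
apply: eq_Rintegral => t _; rewrite /G mul1r psi_jk_shift; congr (phi _ * _).
by rewrite intrD opprD addrA.
Qed.

End wavelet_filter.

(** * Summation by parts against vanishing moments *)

Section vanishing_moments.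
Context {R : realFieldType}.

Definition fdiff (y : nat -> R) (i : nat) : R := y i.+1 - y i.

Lemma abel_sum (h y : nat -> R) (N : nat) :
  \sum_(i < N.+1) h i * y i =
  (\sum_(i < N.+1) h i) * y N + \sum_(i < N) - (\sum_(l < i.+1) h l) * fdiff y i.
Proof.
elim: N => [|N IH]; first by rewrite !big_ord1 big_ord0 addr0.
rewrite big_ord_recr IH /= [X in _ = X * _ + _]big_ord_recr /=.
rewrite [X in _ = _ + X]big_ord_recr /= /fdiff.
by move: (\sum_(i < N) _) => S; move: (\sum_(i < N.+1) _) => H; ring.
Qed.

(** Each vanishing moment pays for one summation by parts. Binomial moments suit the induction: the
    difference of ['C(i, m.+1)] is ['C(i, m)], so the moment of order [m] of the new weights is that
    of order [m.+1] of [h]. *)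
Lemma filter_iter_fdiff (M N : nat) (h : nat -> R) :
  (forall m, (m < M)%N -> \sum_(i < N) h i * 'C(i, m)%:R = 0) ->
  exists n (g : nat -> R), forall y : nat -> R,
    \sum_(i < N) h i * y i = \sum_(i < n) g i * iter M fdiff y i.
Proof.
elim: M N h => [|M IH] N h mom; first by exists N, h.
case: N mom => [|N] mom.
  by exists 0%N, h => y; rewrite !big_ord0.
have h0 : \sum_(i < N.+1) h i = 0.
  by rewrite -[RHS](mom 0%N)//; apply: eq_bigr => i _; rewrite bin0 mulr1.
pose g i := - (\sum_(l < i.+1) h l).
have E (y : nat -> R) : \sum_(i < N.+1) h i * y i = \sum_(i < N) g i * fdiff y i.
  by rewrite abel_sum h0 mul0r add0r.
have [m mM|n [g' gE]] := IH N g.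
  rewrite -[RHS](mom m.+1)// (E (fun i => 'C(i, m.+1)%:R)).
  by apply: eq_bigr => i _; rewrite /fdiff binS natrD addrAC subrr add0r.
by exists n, g' => y; rewrite E gE -iterSr.
Qed.

Lemma ffact_poly (m : nat) :
  exists2 p : {poly R}, size p = m.+1 & forall i : nat, p.[i%:R] = (i ^_ m)%:R.
Proof.
elim: m => [|m [p sp pE]].
  by exists 1; [rewrite size_poly1|move=> i; rewrite hornerC ffactn0].
exists (p * ('X - m%:R%:P)).
  by rewrite size_Mmonic ?monicXsubC ?size_XsubC ?sp ?addn2// -size_poly_eq0 sp.
move=> i; rewrite hornerM pE hornerXsubC ffactnSr natrM.
(* For [i < m] the subtraction [i - m] truncates in [nat] but not in the ring; the factor [i ^_ m]
   is then 0. *)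
have [mi|im] := leqP m i; first by rewrite natrB.
by rewrite ffact_small// !mul0r.
Qed.

(** Up to the factor [m!], the binomial coefficient is a falling factorial, a polynomial of degree
    [m] in [i], so these moments are combinations of the power moments. *)
Lemma binomial_moments (M N : nat) (h : nat -> R) :
  (forall l, (l < M)%N -> \sum_(i < N) h i * i%:R ^+ l = 0) ->
  forall m, (m < M)%N -> \sum_(i < N) h i * 'C(i, m)%:R = 0.
Proof.
move=> mom m mM; have [p sp pE] := ffact_poly m.
have f0 : m`!%:R != 0 :> R by rewrite pnatr_eq0 -lt0n fact_gt0.
apply: (mulIf f0); rewrite mul0r mulr_suml.
transitivity (\sum_(i < N) h i * p.[i%:R]).
  by apply: eq_bigr => i _; rewrite pE -mulrA -natrM bin_ffact.
transitivity (\sum_(l < size p) p`_l * (\sum_(i < N) h i * i%:R ^+ l)).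
  under [RHS]eq_bigr do rewrite mulr_sumr.
  rewrite exchange_big; apply: eq_bigr => i _ /=.
  rewrite horner_coef mulr_sumr; apply: eq_bigr => l _; ring.
rewrite big1// => l _; rewrite mom ?mulr0//.
by apply: leq_trans (ltn_ord l) _; rewrite sp.
Qed.

End vanishing_moments.

(** [Delta] is a backward difference and [fdiff] a forward one, hence the shift by [M]. *)
Lemma iter_Delta_fdiff (R : realType) d (Omega : measurableType d) (X : int -> Omega -> R)
    (w : Omega) (a : int) (M i : nat) :
  iter M fdiff (fun i => X (a + i%:Z) w) i = iter M Delta X (a + M%:Z + i%:Z) w.
Proof.
elim: M i => [|M IH] i /=; first by rewrite addr0.
rewrite /fdiff /Delta !IH; congr (iter M Delta X _ w - iter M Delta X _ w).
  by rewrite !intS; ring.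
by rewrite !intS; ring.
Qed.

(** * Second moments of filters of stationary sequences *)

Section stationary_filter.
Context {R : realType} {d : measure_display} {Omega : measurableType d}.
Variable P : probability Omega R.

Lemma stationary_product_moment (Y : int -> Omega -> R) (k h : int) :
  covariance_stationary P Y ->
  P.-integrable setT (EFin \o (fun w => Y (k + h) w * Y k w)) /\
  \int[P]_w (Y (k + h) w * Y k w) = \int[P]_w (Y h w * Y 0 w).
Proof.
move=> [Y2 Ym Yc].
have Y1 l : Y l \in Lfun P 1 by apply: Lfun_subset12; rewrite ?fin_num_measure.
have YY l m : (Y l * Y m)%R \in Lfun P 1 by exact: Lfun2_mul_Lfun1.
have YYI l m : P.-integrable setT (EFin \o (fun w => Y l w * Y m w)).
  exact/Lfun1_integrable/YY.
split; first exact: YYI.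
have E l m : 'E_P[Y l * Y m]%E = (covariance P (Y l) (Y m) + 'E_P[Y 0%R] * 'E_P[Y 0%R])%E.
  rewrite covarianceE// !Ym subeK// fin_numM// expectation_fin_num//.
have : 'E_P[Y (k + h)%R * Y k]%E = ('E_P[Y h * Y 0%R])%E by rewrite !E Yc.
by rewrite unlock /Rintegral => ->.
Qed.

Lemma stationary_filter_moment (Y : int -> Omega -> R) (n : nat) (q : nat -> R) (a b : int) :
  covariance_stationary P Y ->
  \int[P]_w (\sum_(i < n) q i * Y (a + i%:Z) w) ^+ 2 =
  \int[P]_w (\sum_(i < n) q i * Y (b + i%:Z) w) ^+ 2.
Proof.
move=> sY.
suff H c : \int[P]_w (\sum_(i < n) q i * Y (c + i%:Z) w) ^+ 2 =
    \sum_(i < n) \sum_(l < n) q i * q l * \int[P]_w (Y (i%:Z - l%:Z) w * Y 0 w).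
  by rewrite !H.
have IY i l : P.-integrable setT (EFin \o (fun w => Y i w * Y l w)).
  by rewrite -(subrK l i) addrC; have [] := stationary_product_moment l (i - l) sY.
pose F (i l : nat) w := q i * q l * (Y (c + i%:Z) w * Y (c + l%:Z) w).
have IF i l : P.-integrable setT (EFin \o F i l).
  exact: (integrableZl measurableT _ (IY _ _)).
pose G (i : nat) w := \sum_(l < n) F i l w.
have IG i : P.-integrable setT (EFin \o G i).
  by have [] := Rintegral_sum (n := n) (fun l _ => IF i l).
transitivity (\int[P]_w (\sum_(i < n) G i w)).
  apply: eq_Rintegral => w _; rewrite expr2 mulr_suml; apply: eq_bigr => i _.
  by rewrite mulr_sumr; apply: eq_bigr => l _; rewrite /F; ring.
have [_ ->] := Rintegral_sum (n := n) (fun i _ => IG i).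
apply: eq_bigr => i _.
have [_ ->] := Rintegral_sum (n := n) (fun l _ => IF i l).
apply: eq_bigr => l _; rewrite /F (RintegralZl _ measurableT (IY _ _)).
have [_ <-] := stationary_product_moment (c + l%:Z) (i%:Z - l%:Z) sY.
congr (_ * _); apply: eq_Rintegral => w _; congr (Y _ w * _); ring.
Qed.

(** The bound on [M] allows differencing of order [M] in [memory_parameter]. The coefficients at
    scale [j] apply one set of weights to shifts of the resulting stationary sequence, and centring
    turns the common second moment into the variance at [k = 0]. *)
Lemma wavelet_coef_second_moment (X : int -> Omega -> R) (d0 : R)
    (nu : {measure set (measurableTypeR R) -> \bar R}) (M : nat) (alpha : R)
    (T : nat) (phi psi : R -> R) (j : nat) (k : int) :
  let W := wavelet_coef X phi psi in
  memory_parameter P X d0 nu -> admissible_pair M alpha T phi psi ->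
  d0 - 2^-1 < M%:R -> (forall j k, 'E_P[W j k] = 0)%E ->
  W j k \in Lfun P 2%:E /\ ('E_P[W j k ^+ 2] = (fine 'V_P[W j 0%R])%:E)%E.
Proof.
move=> W [nustar [_ _ _ /(_ M) mem]] adm dM W0.
have [mu [_ [sY _]]] := mem dM.
have [h [mom hE]] := wavelet_coef_filter j adm.
have [n [q qE]] := filter_iter_fdiff (binomial_moments mom).
have WE l : W j l = fun w => \sum_(i < n) q i *
    iter M Delta X ((2 ^ j)%:Z * l + M%:Z + i%:Z) w.
  apply/funext => w; rewrite /W hE.
  rewrite (qE (fun i => X ((2 ^ j)%:Z * l + i%:Z) w)).
  by apply: eq_bigr => i _; rewrite iter_Delta_fdiff.
have W2 l : W j l \in Lfun P 2%:E.
  rewrite WE; have [Y2 _ _] := sY.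
  have -> : (fun w => \sum_(i < n) q i * iter M Delta X ((2 ^ j)%:Z * l + M%:Z + i%:Z) w) =
     \sum_(i < n) q i *: iter M Delta X ((2 ^ j)%:Z * l + M%:Z + i%:Z).
    by apply/funext => w; rewrite fct_sumE.
  have p1 : (1 <= 2%:E :> \bar R)%E by rewrite lee1n.
  by apply: rpred_sum => i _; apply: rpredZ.
split=> //.
have VE : ('V_P[W j 0%R] = 'E_P[W j 0%R ^+ 2])%E.
  by rewrite varianceE// W0 expe2 mule0 sube0.
have fin l : ('E_P[W j l ^+ 2])%E \is a fin_num.
  rewrite unlock; apply: integrable_fin_num => //.
  exact: Lfun2_integrable_sqr.
rewrite VE -[LHS]fineK//; congr EFin.
rewrite expectation.unlock.
have := stationary_filter_moment n q ((2 ^ j)%:Z * k + M%:Z) ((2 ^ j)%:Z * 0 + M%:Z) sY.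
by rewrite !WE /Rintegral.
Qed.

End stationary_filter.

(** * Rate of convergence *)

Section scale_errors.
Context {R : realType} {d : measure_display} {Omega : measurableType d}.
Variable P : probability Omega R.

(** Let [rho = s2 / tau] and let [Y] be the energy normalised by [s2], of mean [N]. The error splits
    into [rho (Y - N)], controlled by the variance, and the bias [(rho - 1) N]; then
    [(u + v)^2 <= 2 u^2 + 2 v^2]. *)
Lemma scale_error (W : nat -> Omega -> R) (N : nat) (s2 tau v : R) :
  0 < s2 -> 0 < tau ->
  (forall k, W k \in Lfun P 2%:E) -> (forall k, 'E_P[W k ^+ 2] = s2%:E)%E ->
  ('V_P[fun w => (\sum_(k < N) W k w ^+ 2 / s2)%R] <= v%:E)%E ->
  (\int[P]_w (((\sum_(k < N) W k w ^+ 2 / tau)%R - N%:R) ^+ 2)%:E <=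
   (2 * (s2 / tau) ^+ 2 * v + 2 * (s2 / tau - 1) ^+ 2 * N%:R ^+ 2)%:E)%E.
Proof.
move=> s0 tau0 W2 EW VY.
pose F k w := W k w ^+ 2 / s2.
have IF k : P.-integrable setT (EFin \o F k).
  have := integrableZr measurableT s2^-1 (Lfun2_integrable_sqr (W2 k)).
  by apply: eq_integrable.
pose Y w := \sum_(k < N) F k w.
have [IY EY] := Rintegral_sum (n := N) (fun k _ => IF k).
have mY : measurable_fun setT Y by have /integrableP[/measurable_EFinP] := IY.
have EY1 : fine ('E_P[Y])%E = N%:R.
  rewrite expectation.unlock -/(Rintegral P setT Y) EY.
  transitivity (\sum_(k < N) (1 : R)); last by rewrite sumr_const card_ord.
  apply: eq_bigr => k _; rewrite /F RintegralZr//; last exact: Lfun2_integrable_sqr.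
  by have := EW k; rewrite unlock /Rintegral => -> /=; rewrite divff ?gt_eqF.
have VE : ('V_P[Y] = \int[P]_w ((Y w - N%:R) ^+ 2)%:E)%E.
  by rewrite /variance covariance.unlock EY1 expectation.unlock; apply: eq_integral => w _.
have mYN : measurable_fun setT (fun w => (Y w - N%:R) ^+ 2).
  by apply: measurable_funX; exact: measurable_funB.
set rho := s2 / tau.
have SE w : (\sum_(k < N) W k w ^+ 2 / tau)%R = rho * Y w.
  rewrite /Y mulr_sumr; apply: eq_bigr => k _; rewrite /rho /F; field.
  by rewrite !gt_eqF.
apply: (@le_trans _ _ (\int[P]_w ((2 * rho ^+ 2)%:E * ((Y w - N%:R) ^+ 2)%:E +
    (2 * (rho - 1) ^+ 2 * N%:R ^+ 2)%:E))%E).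
  apply: ge0_le_integral => //.
  - by move=> w _; rewrite lee_fin sqr_ge0.
  - apply/measurable_EFinP; apply: measurable_funX; apply: measurable_funB => //.
    under eq_fun do rewrite SE; exact: measurable_funM.
  - apply: emeasurable_funD => //; apply: measurable_funeM; exact/measurable_EFinP.
  - move=> w _; rewrite -EFinM -EFinD lee_fin SE.
    by have := sqr_ge0 (rho * (Y w - N%:R) - (rho - 1) * N%:R); nra.
have sq0 (x : R) : 0 <= 2 * x ^+ 2 by rewrite mulr_ge0 ?sqr_ge0.
rewrite ge0_integralD//; first last.
- by move=> w _; rewrite lee_fin mulr_ge0// sqr_ge0.
- by apply: measurable_funeM; exact/measurable_EFinP.
- by move=> w _; rewrite -EFinM lee_fin mulr_ge0// sqr_ge0.
rewrite integral_cst// [X in (_ * X)%E]probability_setT mule1.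
rewrite ge0_integralZl//; first last.
- by rewrite lee_fin.
- by move=> w _; rewrite lee_fin sqr_ge0.
- exact/measurable_EFinP.
rewrite -VE EFinD leeD2r// (EFinM _ v) lee_wpmul2l//.
by rewrite lee_fin.
Qed.

(** The full series is [1 / (1 - q)^2 = 16] for [q = 3/4]. *)
Lemma geometric_weights (p : nat) :
  \sum_(i < p) (1 + i%:R) * (3 / 4) ^+ i <= 16 :> R.
Proof.
suff -> : \sum_(i < p) (1 + i%:R) * (3 / 4) ^+ i =
    16 - (16 + 4 * p%:R) * (3 / 4) ^+ p :> R.
  by rewrite gerBl mulr_ge0 ?exprn_ge0 ?addr_ge0 ?mulr_ge0//; lra.
elim: p => [|p IH]; first by rewrite big_ord0 expr0; ring.
by rewrite big_ord_recr IH /= exprS -natr1; field.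
Qed.

(** Markov's inequality is applied once, to a majorant [Q] of the whole weighted sum. Its mean is
    bounded uniformly in the number [p] of scales because the second moments decay geometrically. *)
Lemma markov_weighted_errors (r : nat -> Omega -> R) (p : nat) (b c lambda : R) :
  0 < b -> 0 <= c -> 0 < lambda ->
  (forall i, measurable_fun setT (r i)) ->
  (forall i, (i < p)%N ->
     (\int[P]_w (r i w ^+ 2)%:E <= (c * 2^-1 ^+ i * b ^+ 2)%:E)%E) ->
  exists A : set Omega, [/\ measurable A,
    (P A <= (16 * (1 + c) / lambda)%:E)%E &
    forall w, ~ A w -> \sum_(i < p) (1 + i%:R) * `|r i w| <= lambda * b].
Proof.
move=> b0 c0 l0 mr Er.
(* AM-GM: [|r| <= a + r^2 / a] with [a = q^i b]; any [q] in ]2^(-1/2), 1[ would do. *)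
pose q : R := 3 / 4.
have qi i : 0 < q ^+ i by rewrite exprn_gt0// /q; lra.
pose f i w := (1 + i%:R) * (q ^+ i * b + r i w ^+ 2 / (q ^+ i * b)).
have f0 i w : 0 <= f i w.
  rewrite /f mulr_ge0 ?addr_ge0 ?divr_ge0 ?sqr_ge0 ?mulr_ge0//; try exact: ltW.
have mf i : measurable_fun setT (f i).
  apply: measurable_funM => //; apply: measurable_funD => //.
  by apply: measurable_funM => //; exact: measurable_funX.
pose Q w := \sum_(i < p) f i w.
have mQ : measurable_fun setT Q by apply: measurable_sum.
have Q0 w : 0 <= Q w by rewrite sumr_ge0.
have EQ : (\int[P]_w (Q w)%:E <= (16 * (1 + c) * b)%:E)%E.
  have -> : (\int[P]_w (Q w)%:E = \sum_(i < p) \int[P]_w (f i w)%:E)%E.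
    rewrite -ge0_integral_sum//.
    - by apply: eq_integral => w _; rewrite sumEFin.
    - by move=> i; exact/measurable_EFinP.
    - by move=> i w _; rewrite lee_fin.
  apply: (@le_trans _ _ (\sum_(i < p) ((1 + i%:R) * q ^+ i * ((1 + c) * b))%:E)%E).
    apply: lee_sum => i _.
    have -> : (\int[P]_w (f i w)%:E = ((1 + i%:R) * (q ^+ i * b))%:E +
        ((1 + i%:R) / (q ^+ i * b))%:E * \int[P]_w (r i w ^+ 2)%:E)%E.
      have qb : q ^+ i * b != 0 by rewrite mulf_neq0 ?gt_eqF.
      transitivity (\int[P]_w (((1 + i%:R) * (q ^+ i * b))%:E +
          ((1 + i%:R) / (q ^+ i * b))%:E * (r i w ^+ 2)%:E))%E.
        by apply: eq_integral => w _; rewrite -EFinM -EFinD /f; congr EFin; ring.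
      have mr2 : measurable_fun setT (fun w => (r i w ^+ 2)%:E).
        by apply/measurable_EFinP; exact: measurable_funX.
      have ib0 : 0 <= (1 + i%:R) / (q ^+ i * b).
        by rewrite divr_ge0 ?addr_ge0 ?mulr_ge0 ?(ltW b0) ?(ltW (qi i)).
      rewrite ge0_integralD//; first last.
      - exact: measurable_funeM.
      - by move=> w _; rewrite -EFinM lee_fin mulr_ge0 ?sqr_ge0.
      - by move=> w _; rewrite lee_fin mulr_ge0 ?addr_ge0 ?mulr_ge0 ?(ltW b0) ?(ltW (qi i)).
      rewrite integral_cst// [X in (_ * X)%E]probability_setT mule1 ge0_integralZl//.
      by move=> w _; rewrite lee_fin sqr_ge0.
    have ib0 : 0 <= (1 + i%:R) / (q ^+ i * b).
      by rewrite divr_ge0 ?addr_ge0 ?mulr_ge0 ?(ltW b0) ?(ltW (qi i)).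
    have := lee_wpmul2l (_ : (0 <= ((1 + i%:R) / (q ^+ i * b))%:E)%E) (Er i (ltn_ord i)).
    rewrite lee_fin => /(_ ib0) H.
    apply: (le_trans (leeD2l _ H)); rewrite -EFinM -EFinD lee_fin.
    have hq : 2^-1 ^+ i <= q ^+ i * q ^+ i.
      by rewrite -exprMn lerXn2r ?nnegrE// /q; lra.
    rewrite [leRHS](_ : _ = (1 + i%:R) * (q ^+ i * b) +
      (1 + i%:R) * (q ^+ i * c * b)); last by ring.
    rewrite lerD2l [leLHS](_ : _ =
      (1 + i%:R) * (c * 2^-1 ^+ i * b ^+ 2 / (q ^+ i * b))); last by ring.
    rewrite ler_wpM2l ?addr_ge0// ler_pdivrMr ?mulr_gt0//.
    rewrite [leRHS](_ : _ = c * (q ^+ i * q ^+ i) * b ^+ 2); last by ring.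
    by rewrite ler_wpM2r ?sqr_ge0// ler_wpM2l.
  rewrite sumEFin lee_fin -mulr_suml -mulrA ler_wpM2r ?mulr_ge0 ?addr_ge0 ?(ltW b0)//.
  exact: geometric_weights.
exists [set w | lambda * b <= Q w]; split.
- rewrite (_ : [set w | _] = Q @^-1` `[lambda * b, +oo[).
    by rewrite -[X in measurable X]setTI; apply: mQ => //; exact: measurable_itv.
  by apply/seteqP; split => w /=; rewrite in_itv /= andbT.
- have lb0 : 0 < lambda * b by rewrite mulr_gt0.
  have mQE : measurable_fun setT (EFin \o Q) by exact/measurable_EFinP.
  have := @le_integral_comp_abse _ _ _ P setT measurableT _ _ id
    (@measurable_id _ _ _) (fun _ => id) (fun _ _ _ _ => id) mQE lb0.
  rewrite setTI; under eq_integral do rewrite /= ger0_norm//.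
  rewrite (_ : [set x | _] = [set w | lambda * b <= Q w]); last first.
    by apply/seteqP; split => w /=; rewrite lee_fin ger0_norm.
  move=> H; have := le_trans H EQ.
  rewrite -lee_pdivlMl// -EFinM => /le_trans; apply; rewrite lee_fin.
  by rewrite le_eqVlt; apply/orP; left; apply/eqP; field; rewrite !gt_eqF.
- move=> w /= /negP; rewrite -ltNge => /ltW; apply: le_trans.
  apply: ler_sum => i _; rewrite /f ler_wpM2l ?addr_ge0//.
  have a0 : 0 < q ^+ i * b by rewrite mulr_gt0.
  move: (q ^+ i * b) a0 => a a0.
  rewrite -(ler_pM2r a0) mulrDl divfK ?gt_eqF// -[r i w ^+ 2]real_normK ?num_real//.
  by have := normr_ge0 (r i w); move: `|r i w| => x; nra.
Qed.

End scale_errors.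

(** * Minimisers of the contrast *)

Section contrast.
Context {R : realType}.

Lemma sum_scale_set (T n L U : nat) (F : nat -> int -> R) :
  \sum_(p <- scale_set R T n L U) F p.1 p.2 =
  \sum_(L <= j < U.+1) \sum_(k < ncoef R T n j) F j (Posz k).
Proof.
have ->: \sum_(p <- scale_set R T n L U) F p.1 p.2 =
    \sum_(p <- [seq (j, Posz k) | j <- index_iota L U.+1, k <- iota 0 (ncoef R T n j)])
      F p.1 p.2.
  apply: perm_big; apply: uniq_perm; first exact: fset_uniq.
    apply: allpairs_uniq_dep => [|j _|]; rewrite ?iota_uniq//.
    by move=> [j k] [j' k'] _ _ /= [-> ->].
  by move=> p; rewrite in_fset.
rewrite big_allpairs_dep; apply: eq_bigr => j _.
by rewrite -[in LHS](subn0 (ncoef R T n j)) -/(index_iota 0 _) big_mkord.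
Qed.

Lemma sum_scale_set_shift (T n L U : nat) (F : nat -> int -> R) : (L <= U)%N ->
  \sum_(p <- scale_set R T n L U) F p.1 p.2 =
  \sum_(i < (U - L).+1) \sum_(k < ncoef R T n (L + i)) F (L + i)%N (Posz k).
Proof.
move=> LU; rewrite sum_scale_set -[X in \sum_(X <= _ < _) _]add0n big_addn subSn//.
by rewrite big_mkord; apply: eq_bigr => i _; rewrite addnC.
Qed.

(** The centring identity that [contrast_growth] asks of its [mu]. *)
Lemma mean_scaleP (T n L U : nat) : (L <= U)%N -> (0 < ncoef R T n L)%N ->
  (mean_scale R (scale_set R T n L U) - L%:R) *
    (\sum_(i < (U - L).+1) (ncoef R T n (L + i))%:R) =
  \sum_(i < (U - L).+1) i%:R * (ncoef R T n (L + i))%:R.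
Proof.
move=> LU nL.
have cE : #|` scale_set R T n L U|%:R =
    \sum_(i < (U - L).+1) (ncoef R T n (L + i))%:R :> R.
  have := sum_scale_set_shift T n (fun _ _ => 1 : R) LU.
  rewrite big_const_seq count_predT iter_addr_0 => ->.
  by apply: eq_bigr => i _; rewrite sumr_const card_ord.
have c0 : #|` scale_set R T n L U|%:R != 0 :> R.
  rewrite cE big_ord_recl /= addn0 gt_eqF// ltr_pwDl ?ltr0n//.
  by rewrite sumr_ge0.
rewrite mulrBl -cE /mean_scale -mulrA mulrCA mulVf// mulr1.
rewrite (sum_scale_set_shift T n (fun j _ => j%:R : R) LU) cE mulr_sumr -sumrB.
by apply: eq_bigr => i _; rewrite sumr_const card_ord natrD -mulr_natr; ring.
Qed.

(** Gives [2 * ln 2 >= 1], so that a bound on [2 * ln 2 * (x - d0)] passes to [x - d0]. It amounts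
    to [expR (- 1/2) >= 1 - 1/2]. *)
Lemma ln2_ge_half : 2^-1 <= ln 2 :> R.
Proof.
have h : (2 : R)^-1 <= expR (- 2^-1) by have := @expR_ge1Dx R (- 2^-1); lra.
rewrite -[leLHS]expRK ler_ln ?posrE ?expR_gt0//.
by move: h; rewrite expRN lef_pV2 ?posrE ?expR_gt0.
Qed.

(** Normalised by the limiting variance and not by the variance at the scale itself: this is what
    makes the contrast a function of [x - d0]. *)
Definition scale_energy (T n L : nat) (W : nat -> int -> R) (d0 sigma2 : R) (i : nat) : R :=
  \sum_(k < ncoef R T n (L + i))
    W (L + i)%N (Posz k) ^+ 2 / (sigma2 * 2 `^ (2 * d0 * (L + i)%:R)).

(** The prefactor does not involve [x], so minimising the contrast means minimising the exponential
    sum in [theta = 2 ln 2 (x - d0)]. *)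
Lemma contrastE (T n L U : nat) (W : nat -> int -> R) (d0 sigma2 x : R) :
  (L <= U)%N -> 0 < sigma2 ->
  let I := scale_set R T n L U in
  contrast I W x =
  ln (sigma2 * 2 `^ (2 * d0 * mean_scale R I) *
      \sum_(i < (U - L).+1)
        expR (2 * ln 2 * (x - d0) * (mean_scale R I - L%:R - i%:R)) *
        scale_energy T n L W d0 sigma2 i).
Proof.
move=> LU s0 I; rewrite /contrast; congr ln.
rewrite (sum_scale_set_shift T n (fun j k =>
  2 `^ (2 * x * (mean_scale R I - j%:R)) * W j k ^+ 2) LU).
rewrite mulr_sumr; apply: eq_bigr => i _.
rewrite /scale_energy !mulr_sumr; apply: eq_bigr => k _.
set m := mean_scale R I; set v := W _ _.
have pE y : 2 `^ y = expR (y * ln 2) :> R by rewrite /powR pnatr_eq0.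
rewrite !pE.
have -> : 2 * x * (m - (L + i)%:R) * ln 2 = 2 * d0 * m * ln 2 +
    2 * ln 2 * (x - d0) * (m - L%:R - i%:R) - 2 * d0 * (L + i)%:R * ln 2.
  by rewrite natrD; ring.
rewrite expRD expRN expRD.
by field; rewrite (gt_eqF s0) (gt_eqF (expR_gt0 _)).
Qed.

Lemma continuous_expR_sum (p : nat) (S a : nat -> R) (c d0 : R) :
  continuous (fun x : R => \sum_(i < p) expR (c * (x - d0) * a i) * S i).
Proof.
elim: p => [|p IH].
  under eq_fun do rewrite big_ord0; exact: cst_continuous.
under eq_fun do rewrite big_ord_recr /=.
move=> x; apply: cvgD; first exact: IH.
apply: cvgMr_tmp; apply: (cvg_comp (fun x => c * (x - d0) * a p) (@expR R)).
  by apply: cvgMr_tmp; apply: cvgMl_tmp; apply: cvgB; [exact: cvg_id|exact: cvg_cst].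
exact: continuous_expR.
Qed.

(** The sublevel set of [x0] is bounded, so a minimum over a compact interval containing it is
    global. *)
Lemma coercive_argmin (F : R -> R) (x0 B : R) : 0 <= B ->
  continuous F -> (forall y, F y <= F x0 -> `|y - x0| <= B) ->
  exists x, forall y, F x <= F y.
Proof.
move=> B0 cF hB; have ab : x0 - B <= x0 + B by lra.
have [x xab xmin] := EVT_min ab (continuous_subspaceT cF).
have x0in : x0 \in `[x0 - B, x0 + B] by rewrite in_itv /=; lra.
exists x => y; have [yx0|/ltW x0y] := leP (F y) (F x0).
  apply: xmin; have := hB y yx0; rewrite ler_norml in_itv /=; lra.
exact: le_trans (xmin _ x0in) x0y.
Qed.

Lemma estimator_error (T n L U : nat) (W : nat -> int -> R)
    (d0 sigma2 eta dh : R) :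
  let I := scale_set R T n L U in
  let N i := (ncoef R T n (L + i))%:R : R in
  (L < U)%N -> 0 < sigma2 -> 0 < N 0 ->
  (forall i, 2 * N i.+1 <= N i) -> N 0 <= 4 * N 1 -> N 0 <= 8 * N 2 ->
  \sum_(i < (U - L).+1) (1 + i%:R) * `|scale_energy T n L W d0 sigma2 i - N i|
    <= eta * N 0 ->
  eta <= 16^-1 ->
  (contrast_argmin I W !=set0 -> contrast_argmin I W dh) ->
  `|dh - d0| <= 512 * eta.
Proof.
move=> I N LU s0 N0 half N1 N2 err eta16 dhP.
set S := scale_energy T n L W d0 sigma2 in err.
have Sge0 i : 0 <= S i.
  apply: sumr_ge0 => k _; rewrite divr_ge0 ?sqr_ge0// mulr_ge0 ?powR_ge0//.
  exact: ltW.
have eta0 : 0 <= eta.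
  rewrite -(pmulr_lge0 _ N0); apply: le_trans err.
  by apply: sumr_ge0 => i _; rewrite mulr_ge0 ?addr_ge0.
(* Keeps the exponential sum positive, so [ln] compares its values faithfully and the default
   [ln 0 = 0] never enters. *)
have S0 : 0 < S 0.
  have : `|S 0 - N 0| <= eta * N 0.
    apply: le_trans err; rewrite big_ord_recl /= addr0 mul1r lerDl.
    by apply: sumr_ge0 => i _; rewrite mulr_ge0 ?addr_ge0.
  by rewrite ler_norml => /andP[+ _]; nra.
pose mu := mean_scale R I - L%:R.
pose G x := \sum_(i < (U - L).+1) expR (2 * ln 2 * (x - d0) * (mu - i%:R)) * S i.
have G0 x : 0 < G x.
  rewrite /G big_ord_recl ltr_pwDl//; first by rewrite mulr_gt0 ?expR_gt0.
  by apply: sumr_ge0 => i _; rewrite mulr_ge0 ?expR_ge0.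
pose kappa := sigma2 * 2 `^ (2 * d0 * mean_scale R I).
have kappa0 : 0 < kappa by rewrite mulr_gt0 ?powR_gt0.
have CE x y : (contrast I W x <= contrast I W y) = (G x <= G y).
  rewrite (contrastE T n W d0 x (ltnW LU) s0) (contrastE T n W d0 y (ltnW LU) s0).
  by rewrite -/I -/kappa -/S -/mu ler_ln ?posrE ?mulr_gt0 ?G0// ler_pM2l.
have bound x : G x <= G d0 -> `|x - d0| <= 512 * eta.
  move=> Gx.
  have : `|2 * ln 2 * (x - d0)| <= 512 * eta.
    apply: (@contrast_growth _ N S (U - L) _ _ mu) => //.
    - by rewrite subn_gt0.
    - by apply: mean_scaleP; [exact: ltnW|rewrite -(ltr0n R); rewrite /N addn0 in N0].
    - apply: le_trans Gx _; rewrite /G subrr mulr0.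
      by under eq_bigr do rewrite mul0r expR0 mul1r.
  have l2 := ln2_ge_half.
  rewrite normrM ger0_norm; last by lra.
  by apply: le_trans; have := normr_ge0 (x - d0); nra.
have B0 : 0 <= 512 * eta by clear - eta0; lra.
have cG : continuous G.
  exact: (@continuous_expR_sum _ S (fun i => mu - i%:R) (2 * ln 2) d0).
(* The hypothesis on [dh] is conditional on the existence of a minimiser, which the growth bound
   itself provides. *)
have [x xmin] := coercive_argmin B0 cG bound.
apply: bound; rewrite -CE; apply: dhP; exists x => y; by rewrite CE.
Qed.

End contrast.

(** * Numbers of coefficients per scale *)

Section sample_sizes.
Context {R : realType}.
Implicit Types (T n j : nat).

(** Doubling the real number truncated at scale [j.+1] turns the shift [1 - T] into [2 (1 - T)],
    which is no larger as [T >= 1]; an integer below a real is below its integer part. *)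
Lemma ncoef_half T n j : (1 <= T)%N ->
  2 * (ncoef R T n j.+1)%:R <= (ncoef R T n j)%:R :> R.
Proof.
move=> T1; rewrite -natrM ler_nat {1}/ncoef; case E : (Num.truncn _) => [|t].
  by rewrite muln0.
have : (t < t.+1)%N by [].
rewrite -[in X in (_ < X)%N]E truncn_gt_nat => tx.
rewrite mul2n doubleS /ncoef truncn_gt_nat.
have T1' : 1 <= T%:R :> R by rewrite ler1n.
move: tx; rewrite !powRN !powR_mulrn// exprS invfM -doubleS -mul2n natrM.
by move: (t.+1%:R : R) => x; lra.
Qed.

(** The shifts cost at most [2 (T - 1)] and the integer part at most 1. *)
Lemma ncoef_ge_real T n j : (1 <= T)%N ->
  2 `^ (- j%:R) * n%:R - 2 * T%:R <= (ncoef R T n j)%:R :> R.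
Proof.
move=> T1; have /ltW := real_truncnS_gt (num_real
  (2 `^ (- j%:R) * (n%:R - T%:R + 1) - T%:R + 1 : R)).
rewrite -/(ncoef R T n j) -natr1.
have T1' : 1 <= T%:R :> R by rewrite ler1n.
have z0 : 0 <= 2 `^ (- j%:R) :> R by exact: powR_ge0.
have z1 : 2 `^ (- j%:R) <= 1 :> R.
  by rewrite powRN powR_mulrn// invf_le1 ?exprn_gt0// exprn_ege1// ler1n.
nra.
Qed.

Lemma ncoef_le_real T n j : (1 <= T)%N ->
  (ncoef R T n j)%:R <= 2 `^ (- j%:R) * n%:R :> R.
Proof.
move=> T1.
have T1' : 1 <= T%:R :> R by rewrite ler1n.
have z0 : 0 <= 2 `^ (- j%:R) :> R by exact: powR_ge0.
case E : (ncoef R T n j) => [|t]; first by rewrite mulr_ge0.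
have : (t < ncoef R T n j)%N by rewrite E.
rewrite /ncoef truncn_gt_nat => /le_trans; apply.
nra.
Qed.

Lemma ncoef_noninc T n j l : (1 <= T)%N -> (j <= l)%N ->
  (ncoef R T n l <= ncoef R T n j)%N.
Proof.
move=> T1 /subnK <-; elim: (l - j)%N => [|m IH]; first by rewrite add0n.
rewrite addSn; apply: leq_trans IH; rewrite -(ler_nat R).
have := ncoef_half n (m + j) T1; have : 0 <= (ncoef R T n (m + j).+1)%:R :> R by [].
lra.
Qed.

Lemma ncoef_geom T n L i : (1 <= T)%N ->
  (ncoef R T n (L + i))%:R <= 2^-1 ^+ i * (ncoef R T n L)%:R :> R.
Proof.
move=> T1; elim: i => [|i IH]; first by rewrite addn0 expr0 mul1r.
by rewrite addnS exprS; have := ncoef_half n (L + i) T1; lra.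
Qed.

(** Since [ncoef] is nonincreasing in the scale, the scales with a coefficient form an initial
    segment. The condition [1 <= j] avoids the value 0 that [Jmax] takes by default. *)
Lemma ncoef_Jmax T n j : (1 <= T)%N -> (1 <= j <= Jmax R T n)%N ->
  (1 <= ncoef R T n j)%N.
Proof.
move=> T1 /andP[j1 jJ]; rewrite leqNgt; apply/negP; rewrite ltnS leqn0 => /eqP n0.
have : (Jmax R T n <= j.-1)%N.
  apply/bigmax_leqP => i ni; rewrite -ltnS (prednK j1) ltnNge; apply/negP => ji.
  by have := ncoef_noninc n T1 ji; rewrite n0 leqNgt ni.
by rewrite leqNgt prednK// jJ.
Qed.

End sample_sizes.

(** * Consequences of the growth of L *)

Section rates.
Context {R : realType}.
Variables (beta : R) (L : nat -> nat).
Hypothesis beta0 : 0 < beta.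
Hypothesis nL : asymp (fun n => n%:R) (fun n => 2 `^ ((1 + 2 * beta) * (L n)%:R) : R).

Let beta1 : 0 < 1 + 2 * beta. Proof. by have := beta0; lra. Qed.
Let gamma0 : 0 < beta / (1 + 2 * beta). Proof. exact: divr_gt0. Qed.

(** The upper bound [n <= C 2^((1 + 2 beta) L)] raised to the power [beta / (1 + 2 beta)]. *)
Lemma asymp_scale_rate : exists2 K : R, 0 < K & \forall n \near \oo,
  2 `^ (- (beta * (L n)%:R)) <= K * n%:R `^ (- (beta / (1 + 2 * beta))).
Proof.
have [c [C [c0 cC]]] := nL.
have C0 : 0 < C.
  by have [N _ /(_ N (leqnn _))/= /andP[h1 h2]] := cC; apply: lt_le_trans (le_trans h1 h2).
exists (C `^ (beta / (1 + 2 * beta))); first exact: powR_gt0.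
near=> n.
have n0 : 0 < n%:R :> R by rewrite ltr0n; near: n; exists 1%N.
have : n%:R / 2 `^ ((1 + 2 * beta) * (L n)%:R) <= C.
  by near: n; apply: filterS cC => n /andP[].
rewrite ler_pdivrMr ?powR_gt0// => nC.
rewrite !powRN ler_pdivlMr ?powR_gt0// mulrC ler_pdivrMr ?powR_gt0//.
have -> : 2 `^ (beta * (L n)%:R) =
    (2 `^ ((1 + 2 * beta) * (L n)%:R)) `^ (beta / (1 + 2 * beta)) :> R.
  by rewrite -powRrM; congr (_ `^ _); field; rewrite gt_eqF.
rewrite -powRM ?powR_ge0 ?(ltW C0)//.
by apply: ge0_ler_powR; rewrite ?nnegrE ?(ltW gamma0) ?(ltW n0) ?mulr_ge0 ?powR_ge0 ?(ltW C0).
Unshelve. all: by end_near. Qed.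

(** Divergence of [L n], in the form that absorbs constants. *)
Lemma asymp_scale_large (B : R) : \forall n \near \oo, B <= 2 `^ (beta * (L n)%:R).
Proof.
have [K K0 KL] := asymp_scale_rate.
pose B' := Num.max 1 B.
have B0 : 0 < B' by rewrite lt_max ltr01.
near=> n.
apply: (@le_trans _ _ B'); first by rewrite le_max lexx orbT.
have n0 : 0 < n%:R :> R by rewrite ltr0n; near: n; exists 1%N.
have : 2 `^ (- (beta * (L n)%:R)) <= K * n%:R `^ (- (beta / (1 + 2 * beta))).
  by near: n; exact: KL.
rewrite !powRN ler_pdivlMr ?powR_gt0// mulrC ler_pdivrMr ?powR_gt0// => H.
rewrite -(ler_pM2l K0); apply: le_trans H.
have KB0 : 0 < K * B' by rewrite mulr_gt0.
have -> : K * B' = ((K * B') `^ (beta / (1 + 2 * beta))^-1) `^ (beta / (1 + 2 * beta)).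
  by rewrite -powRrM mulVf ?gt_eqF// powRr1// ltW.
apply: ge0_ler_powR; rewrite ?nnegrE ?(ltW gamma0) ?(ltW n0) ?powR_ge0//.
by near: n; exact: nbhs_infty_ger.
Unshelve. all: by end_near. Qed.

(** The lower bound of the asymptotic equivalence: the squared bias [2^(-2 beta L)] is at least of
    the order of the sampling variance [1 / n_L]. *)
Lemma asymp_scale_size : exists2 c : R, 0 < c & \forall n \near \oo,
  c <= 2 `^ (- (L n)%:R) * n%:R * (2 `^ (- (beta * (L n)%:R))) ^+ 2.
Proof.
have [c [C [c0 cC]]] := nL; exists c => //.
apply: filterS cC => n /andP[+ _]; move/le_trans; apply.
rewrite le_eqVlt; apply/orP; left; apply/eqP.
rewrite -powRN mulrC [in RHS]mulrAC; congr (_ * _).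
by rewrite -powR_mulrn ?powR_ge0// -powRrM -powRD ?pnatr_eq0 ?implybT//; congr (_ `^ _); ring.
Qed.

End rates.

Lemma ereal_sup_bound (R : realType) (S : set (\bar R)) : (ereal_sup S < +oo)%E ->
  exists2 V : R, 0 <= V & forall x, S x -> (x <= V%:E)%E.
Proof.
move=> Soo; exists (Num.max 0 (fine (ereal_sup S))); first by rewrite le_max lexx.
move=> x Sx; apply: (@le_trans _ _ (ereal_sup S)); first exact: ereal_sup_ubound.
case: (ereal_sup S) Soo => [s|//|] _; last exact: leNye.
by rewrite lee_fin le_max lexx orbT.
Qed.

(** To be read with [x = 2^(-beta L)], [y = 2^(-beta j)], [h = 2^(L - j)], [N0 = n_L], [N = n_j] and
    [rho] the ratio of the variance at scale [j] to its limiting form. The last hypothesis absorbs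
    the pure variance term, [N <= K h (N0 x)^2]; the factor [h] is the decay used by
    [markov_weighted_errors]. *)
Lemma scale_error_rate (R : realType) (A V0 K h x y rho N0 N : R) :
  0 <= A -> 0 <= V0 -> 0 <= K -> 0 <= h <= 1 -> 0 <= y <= x -> x <= 1 ->
  0 <= rho -> `|rho - 1| <= A * y -> 0 <= N -> N <= h * N0 -> 0 <= N0 ->
  1 <= K * N0 * x ^+ 2 ->
  2 * rho ^+ 2 * (V0 * N * (1 + N * y ^+ 2)) + 2 * (rho - 1) ^+ 2 * N ^+ 2 <=
  (2 * (1 + A) ^+ 2 * V0 * (K + 1) + 2 * A ^+ 2) * h * (N0 * x) ^+ 2.
Proof.
move=> A0 V00 K0 /andP[h0 h1] /andP[y0 yx] x1 rho0 rhoA Nge0 Nh N00 KN.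
have x0 : 0 <= x by exact: le_trans yx.
have y1 : y <= 1 by exact: le_trans x1.
have rho1 : rho <= 1 + A.
  move: rhoA; rewrite ler_norml => /andP[_ H].
  have : A * y <= A by rewrite ler_piMr.
  lra.
have rho2 : rho ^+ 2 <= (1 + A) ^+ 2 by rewrite lerXn2r ?nnegrE ?addr_ge0.
have rhoA2 : (rho - 1) ^+ 2 <= A ^+ 2 * y ^+ 2.
  by rewrite -exprMn -[leLHS]real_normK ?num_real// lerXn2r ?nnegrE ?mulr_ge0.
have y2 : y ^+ 2 <= x ^+ 2 by rewrite lerXn2r ?nnegrE.
have Ny : N ^+ 2 * y ^+ 2 <= h * (N0 * x) ^+ 2.
  rewrite exprMn [leRHS]mulrA ler_pM ?sqr_ge0//.
  apply: (@le_trans _ _ ((h * N0) ^+ 2)); first by rewrite lerXn2r ?nnegrE ?mulr_ge0.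
  by rewrite exprMn ler_wpM2r ?sqr_ge0// expr2 ler_piMr.
have NK : N <= K * (h * (N0 * x) ^+ 2).
  apply: le_trans Nh _.
  rewrite (_ : K * _ = h * N0 * (K * N0 * x ^+ 2)); last by ring.
  by rewrite ler_peMr ?mulr_ge0.
have b0 : 0 <= h * (N0 * x) ^+ 2 by rewrite mulr_ge0 ?sqr_ge0.
rewrite (_ : (_ + _) * h * _ = 2 * (1 + A) ^+ 2 * (V0 * ((K + 1) * (h * (N0 * x) ^+ 2)))
   + 2 * (A ^+ 2 * (h * (N0 * x) ^+ 2))); last by ring.
apply: lerD.
  rewrite ler_pM ?mulr_ge0 ?sqr_ge0 ?addr_ge0 ?mulr_ge0 ?sqr_ge0//.
    by rewrite ler_pM2l.
  rewrite -mulrA ler_wpM2l// mulrDr mulr1 mulrDl mul1r lerD//.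
  by rewrite mulrA -expr2.
rewrite -mulrA ler_pM2l//.
apply: (@le_trans _ _ (A ^+ 2 * y ^+ 2 * N ^+ 2)); first by rewrite ler_wpM2r ?sqr_ge0.
by rewrite -mulrA ler_wpM2l ?sqr_ge0// mulrC.
Qed.

Theorem corollary4 (R : realType) (d : measure_display)
    (Omega : measurableType d) (P : probability Omega R)
    (X : int -> {RV P >-> R}) (d0 : R)
    (nu : {measure set (measurableTypeR R) -> \bar R})
    (M : nat) (alpha : R) (T : nat) (phi psi : R -> R)
    (beta sigma2 : R) (L U : nat -> nat) (dhat : nat -> Omega -> R) :
  let W : nat -> int -> Omega -> R :=
    wavelet_coef (fun k => X k : Omega -> R) phi psi in
  let sigma2_ (j : nat) : R := fine ('V_P[W j 0%R])%E in
  let n_ (n j : nat) : nat := ncoef R T n j in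
  let J (n : nat) : nat := Jmax R T n in
  memory_parameter P (fun k => X k : Omega -> R) d0 nu ->
  admissible_pair M alpha T phi psi ->
  d0 - 2^-1 < M%:R ->
  (forall j k, ('E_P[W j k] = 0)%E) ->
  0 < beta ->
  0 < sigma2 ->
  has_ubound [set 2 `^ (beta * j%:R) *
                  `|sigma2_ j / (sigma2 * 2 `^ (2 * d0 * j%:R)) - 1|
             | j in [set j : nat | (1 <= j)%N]] ->
  (ereal_sup [set ((1 + (n_ p.1 p.2)%:R * 2 `^ (- (2 * p.2%:R * beta)))^-1 *
                   ((n_ p.1 p.2)%:R)^-1)%R%:E *
                  'V_P[fun w => (\sum_(k < n_ p.1 p.2)
                                  W p.2 (Posz k) w ^+ 2 / sigma2_ p.2)%R]
             | p in [set p : nat * nat |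
                      (1 <= p.1)%N /\ (1 <= p.2 <= J p.1)%N]] < +oo)%E ->
  (\forall n \near \oo, (L n < U n <= J n)%N) ->
  asymp (fun n => n%:R) (fun n => 2 `^ ((1 + 2 * beta) * (L n)%:R)) ->
  (forall n, whittle_estimator (scale_set R T n (L n) (U n)) W (dhat n)) ->
  bigO_P P (fun n w => dhat n w - d0)
    (fun n => n%:R `^ (- (beta / (1 + 2 * beta)))).
Proof.
move=> W sigma2_ n_ J mem adm dM W0 beta0 s0 [A0 HA] HV LUJ nL dhatP.
have T1 : (1 <= T)%N by have [[_ _]] := adm.
have W2 j k : W j k \in Lfun P 2%:E /\ ('E_P[W j k ^+ 2] = (sigma2_ j)%:E)%E.
  exact: wavelet_coef_second_moment mem adm dM W0.
pose A := Num.max 0 A0.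
have Age0 : 0 <= A by rewrite /A le_max lexx.
have [V0 V00 {}HV] := ereal_sup_bound HV.
have [K' K'0 rate] := asymp_scale_rate beta0 nL.
have [c c0 size] := asymp_scale_size nL.
have large := asymp_scale_large beta0 nL.
(* Below, [n_L] is at least half of [z = 2^-L n], and [z x^2 >= c]. *)
pose K := 2 / c.
have Kge0 : 0 <= K by rewrite divr_ge0// ltW.
pose c4 := 2 * (1 + A) ^+ 2 * V0 * (K + 1) + 2 * A ^+ 2.
have c40 : 0 <= c4.
  by rewrite addr_ge0 ?mulr_ge0 ?sqr_ge0 ?addr_ge0.
move=> eps eps0.
(* Makes the probability bound of [markov_weighted_errors] equal to [eps]. *)
pose lambda := 16 * (1 + c4) / eps.
have l0 : 0 < lambda by rewrite divr_gt0// mulr_gt0// ltr_pwDl.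
have [D D0 DE] : exists2 D : R, 0 < D & D = 512 by exists 512; rewrite ?ltr0n.
exists (D * lambda * K'); first by rewrite mulr_gt0// mulr_gt0.
near=> n.
(* Four thresholds: [B2] forces [L n >= 1], [BA] keeps the variance ratios above 1/2, [Bl] makes
   [lambda * x] at most 1/16, and [BT] makes the rounding in [n_j] negligible at the first three
   scales. *)
have B2 : 2 <= 2 `^ (beta * (L n)%:R) by near: n; exact: large.
have BA : 2 * (A + 1) <= 2 `^ (beta * (L n)%:R) by near: n; exact: large.
have Bl : 16 * lambda <= 2 `^ (beta * (L n)%:R) by near: n; exact: large.
have BT : 16 * T%:R / c + 1 <= 2 `^ (beta * (L n)%:R) by near: n; exact: large.
have zx : c <= 2 `^ (- (L n)%:R) * n%:R * (2 `^ (- (beta * (L n)%:R))) ^+ 2.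
  by near: n; exact: size.
have xrate : 2 `^ (- (beta * (L n)%:R)) <= K' * n%:R `^ (- (beta / (1 + 2 * beta))).
  by near: n; exact: rate.
have /andP[LU UJ] : (L n < U n <= J n)%N by near: n.
have n1 : (1 <= n)%N by near: n; exists 1%N.
set B : R := 2 `^ (beta * (L n)%:R) in B2 BA Bl BT.
have B0 : 0 < B by exact: powR_gt0.
set x : R := 2 `^ (- (beta * (L n)%:R)) in zx xrate.
have xB : x = B^-1 by rewrite /x powRN.
have x0 : 0 < x by exact: powR_gt0.
have BX M' : 0 < M' -> M' <= B -> M' * x <= 1.
  by move=> M0 MB; rewrite xB ler_pdivrMr// mul1r.
(* The bias and variance assumptions only concern scales [j >= 1]. *)
have L1 : (1 <= L n)%N.
  rewrite lt0n; apply/negP => /eqP L0; move: B2; rewrite /B L0 mulr0 powRr0; clear; lra.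
pose N i := (ncoef R T n (L n + i))%:R : R.
set z : R := 2 `^ (- (L n)%:R) * n%:R in zx.
have T0 : 0 <= T%:R :> R by [].
have zB : c * B ^+ 2 <= z.
  by rewrite -ler_pdivlMr ?exprn_gt0// -exprVn -xB.
(* The loss [2 T] in [ncoef_ge_real] is then at most [z / 8], exactly what [N2] tolerates. *)
have zT : 16 * T%:R <= z.
  apply: le_trans zB; rewrite [leRHS]mulrC -ler_pdivrMr//.
  by apply: (@le_trans _ _ B); [clear - BT; lra |
    rewrite expr2 ler_peMr ?(ltW B0)//; clear - B2; lra].
have z0 : 0 < z by apply: lt_le_trans zB; rewrite mulr_gt0// exprn_gt0.
have zS i : 2 `^ (- (L n + i)%:R) * n%:R = 2^-1 ^+ i * z.
  rewrite /z natrD opprD powRD ?pnatr_eq0 ?implybT// (powRN _ i%:R) powR_mulrn//.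
  by rewrite exprVn; ring.
have Nle0 : N 0 <= z.
  by have := @ncoef_le_real R T n (L n + 0) T1; rewrite zS expr0 mul1r.
have Nge i : 2^-1 ^+ i * z - 2 * T%:R <= N i.
  by have := @ncoef_ge_real R T n (L n + i) T1; rewrite zS.
have N00 : z / 2 <= N 0 by have := Nge 0%N; rewrite expr0; clear - zT z0; lra.
have N0gt : 0 < N 0 by apply: lt_le_trans N00; rewrite divr_gt0.
have N1 : N 0 <= 4 * N 1 by have := Nge 1%N; rewrite expr1; clear - zT z0 Nle0; lra.
have N2 : N 0 <= 8 * N 2 by have := Nge 2%N; rewrite expr2; clear - zT z0 Nle0; lra.
have half i : 2 * N i.+1 <= N i by rewrite /N addnS; exact: ncoef_half.
have KN : 1 <= K * N 0 * x ^+ 2.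
  apply: (@le_trans _ _ (K * (z / 2) * x ^+ 2)).
    rewrite (_ : K * _ * _ = c^-1 * (z * x ^+ 2)); last by rewrite /K; field; rewrite gt_eqF.
    by rewrite mulrC ler_pdivlMr// mul1r.
  by rewrite ler_wpM2r ?sqr_ge0// ler_wpM2l.
pose r i w := scale_energy T n (L n) (fun j k => W j k w) d0 sigma2 i - N i.
have mW j k : measurable_fun setT (W j k).
  by have [/andP[+ _] _] := W2 j k; rewrite inE.
have mr i : measurable_fun setT (r i).
  apply: measurable_funB => //; apply: measurable_sum => k.
  by apply: measurable_funM => //; exact: measurable_funX.
have Er i : (i < (U n - L n).+1)%N ->
    (\int[P]_w (r i w ^+ 2)%:E <= (c4 * 2^-1 ^+ i * (N 0 * x) ^+ 2)%:E)%E.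
  move=> iU.
  have h01 : 0 <= (2^-1 : R) ^+ i <= 1.
    by rewrite exprn_ge0 ?exprn_ile1 ?invr_ge0 ?invf_le1 ?ler1n.
  set j := (L n + i)%N.
  have jJ : (1 <= j <= J n)%N.
    rewrite (leq_trans L1) ?leq_addr//=; apply: leq_trans UJ.
    by rewrite -(subnKC (ltnW LU)) leq_add2l.
  have /andP[j1 _] := jJ.
  have nj : (1 <= ncoef R T n j)%N by exact: ncoef_Jmax.
  pose tau := sigma2 * 2 `^ (2 * d0 * j%:R).
  have tau0 : 0 < tau by rewrite mulr_gt0 ?powR_gt0.
  pose y : R := 2 `^ (- (beta * j%:R)).
  have y0 : 0 < y by exact: powR_gt0.
  have yx : y <= x.
    rewrite /y /x ler_powR ?ler1n// lerN2 ler_pM2l// ler_nat; exact: leq_addr.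
  have rhoA : `|sigma2_ j / tau - 1| <= A * y.
    rewrite /y powRN ler_pdivlMr ?powR_gt0// mulrC.
    apply: (@le_trans _ _ A0); last by rewrite /A le_max lexx orbT.
    by apply: HA; exists j.
  have x1 : x <= 1 by have := BX 1 ltr01; rewrite mul1r; apply; clear - B2; lra.
  (* Excludes a zero variance, for which dividing by [sigma2_ j] would give 0 and the variance
     assumption would say nothing. *)
  have rho0 : 2^-1 <= sigma2_ j / tau.
    have Ax : 2 * (A + 1) * x <= 1 by apply: BX => //; clear - Age0; lra.
    move: rhoA; rewrite ler_norml => /andP[+ _].
    have : A * y <= A * x := ler_wpM2l Age0 yx; clear - Ax x0; lra.
  have s2j : 0 < sigma2_ j.
    have : 0 < sigma2_ j / tau by clear - rho0; lra.
    by rewrite pmulr_lgt0 ?invr_gt0.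
  have Ni0 : 0 < N i by rewrite ltr0n.
  have V : ('V_P[fun w => (\sum_(k < ncoef R T n j) W j (Posz k) w ^+ 2 / sigma2_ j)%R] <=
      (V0 * N i * (1 + N i * y ^+ 2))%:E)%E.
    have := HV _ (ex_intro2 _ _ (n, j) (conj n1 jJ) erefl).
    rewrite /= -invfM lee_pdivrMl; last first.
      by rewrite mulr_gt0// ltr_pwDl// mulr_ge0 ?powR_ge0// ltW.
    have -> : 2 `^ (- (2 * j%:R * beta)) = y ^+ 2.
      by rewrite /y -powR_mulrn ?powR_ge0// -powRrM; congr (_ `^ _); ring.
    move/le_trans; apply; rewrite -EFinM lee_fin.
    by rewrite [leLHS]mulrC [X in _ * X]mulrC [leLHS]mulrA.
  have := scale_error s2j tau0 (fun k => (W2 j (Posz k)).1) (fun k => (W2 j (Posz k)).2) V.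
  move/le_trans; apply; rewrite lee_fin.
  apply: scale_error_rate => //.
  - by rewrite (ltW y0).
  - by apply: le_trans rho0.
  - by have := @ncoef_geom R T n (L n) i T1; rewrite /N addn0.
have [E [mE PE Eout]] := markov_weighted_errors
  (mulr_gt0 N0gt x0) c40 l0 mr Er.
exists E; split=> //.
  move=> w /= hw; apply: contrapT => /Eout err.
  move: hw; apply/negP; rewrite -leNgt.
  apply: (@le_trans _ _ (D * (lambda * x))).
    (* Here [eta = lambda * x], since the errors outside [E] sum to at most [lambda * (N 0 * x)]. *)
    rewrite DE; apply: (@estimator_error _ T n (L n) (U n) (fun j k => W j k w) _ sigma2) => //.
    - by move: err; rewrite /r (mulrC (N 0)) mulrA.
    - have := BX (16 * lambda) (mulr_gt0 _ l0) Bl; clear; lra.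
    - exact: dhatP.
  rewrite mulrA -(mulrA (D * lambda)) ler_pM2l; first exact: xrate.
  exact: mulr_gt0.
apply: le_trans PE _; rewrite lee_fin /lambda.
by rewrite le_eqVlt; apply/orP; left; apply/eqP; field; rewrite !gt_eqF// ltr_pwDl.
Unshelve. all: by end_near. Qed.
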